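(* Let $\Phi=(\varphi_i)_{i\in\mathcal I}$ be a conformal iterated function system on $\Omega\subset\mathbb R^d$, $d\ge3$, with extension domain $\Omega'$. Suppose that no generator $\varphi_i$ is a similarity, that $\operatorname{dist}(p_i,\Omega')>0$ and $b_i=\varphi_i(\infty)\in\Omega$ for every $i\in\mathcal I$, and that $$\lambda_{\max}<\min\Bigl\{\frac1{N^{2/d}},\frac1{1+K}\Bigr\},\qquad K=\frac{R^2}{\max\{\rho_b,2/C_0\}^2}.$$ Then $\Phi$ lies in the $d_2$-closure of $\mathcal G_T$.
   Context: Let $d\ge3$. A domain is a nonempty connected open set. M\''obius transformations of $\mathbb R^d\cup\{\infty\}$ are finite compositions of similarities $x\mapsto\lambda Ox+b$ ($\lambda>0$, $O\in O(d)$) and inversions in spheres. Conformal maps of domains in $\mathbb R^d$ are (Liouville) restrictions of M\''obius transformations and are identified with them. Fix $\mathcal I=\{1,\dots,N\}$, $N\ge2$, a bounded domain $\Omega\subset\mathbb R^d$ and a domain $\Omega'\supset\overline\Omega$. A conformal iterated function system on $\Omega$ with extension domain $\Omega'$ is a tuple $\Phi=(\varphi_i)_{i\in\mathcal I}$ of conformal maps $\varphi_i:\Omega'\to\mathbb R^d$ with $\varphi_i(\overline\Omega)\subset\Omega$ and $\|D\varphi_i\|<1$ on $\overline\Omega$. $\mathcal S$ is the set of all these, with metric $d_2(\Phi,\Psi)=\max_i(\|\varphi_i-\psi_i\|+\|D\varphi_i-D\psi_i\|+\|D^2\varphi_i-D^2\psi_i\|)$, all norms being suprema over $\overline\Omega$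 (of operator norms). $\lambda_{\max}=\max_i\sup_{\overline\Omega}\|D\varphi_i\|$. For a finite word $\mathtt i=i_1\cdots i_n$ put $f_{\mathtt i}=\varphi_{i_n}\circ\cdots\circ\varphi_{i_1}$ and $T_{\mathtt i}=\nabla\log\|Df_{\mathtt i}\|$ on $\overline\Omega$; for an infinite word, $T_{\mathtt i}$ is the uniform limit on $\overline\Omega$ of $T_{\mathtt i|_n}$, with $\mathtt i|_n$ the length-$n$ prefix (the limit exists). With $\mathcal I^*$ the finite and $\mathcal I^{\mathbb N}$ the infinite words and $|\cdot|$ the length, $Z=\{(\mathtt i,\mathtt j)\in(\mathcal I^{\mathbb N}\cup\mathcal I^* )^2:|\mathtt i|=|\mathtt j|\ge1,\ i_1\ne j_1\}$ and $\mathcal G_T=\{\Phi\in\mathcal S:\inf_{(\mathtt i,\mathtt j)\in Z}\sup_{\overline\Omega}|T_{\mathtt i}-T_{\mathtt j}|>0\}$. Pole constants: $g_i=\varphi_i^{-1}$ on $\mathbb R^d\cup\{\infty\}$, $p_i=\varphi_i^{-1}(\infty)$, $b_i=\varphi_i(\infty)$, $p_{\mathtt k}=f_{\mathtt k}^{-1}(\infty)$ for finite words $\mathtt k$, $C_0=\frac{2}{1-\lambda_{\max}}\max_i\sup_{\overline\Omega}|\nabla\log\|D\varphi_i\||$, with $\operatorname{dist}(\infty,A)=\infty$ for $A\subset\mathbb R^d$, and $\rho_\Phi=\min_i\operatorname{dist}(\varphi_i(\overline\Omega),\partial\Omega)$, $\rho_b=\min\{\min_i\operatorname{dist}(b_i,\partial\Omega),\rho_\Phi\}$,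 $R=\sup\{\operatorname{dist}(p_{\mathtt k},\overline\Omega):\mathtt k\in\mathcal I^*\text{ nonempty}\}$. Under the hypothesis $b_i\in\Omega$ for all $i$, the constants $R$, $\rho_b$, $C_0$ are finite and positive. *)

(* Defs.v *)
From HB Require Import structures.
From mathcomp Require Import all_boot all_order all_algebra.
From mathcomp Require Import all_classical all_reals all_analysis.
Set Implicit Arguments.
Unset Strict Implicit.
Unset Printing Implicit Defensive.
Import Order.TTheory GRing.Theory Num.Theory.
Import numFieldNormedType.Exports.
Local Open Scope classical_set_scope.
Local Open Scope ring_scope.

(* The library norm on 'rV[R]_d is the maximum norm.  It gives the usual
   topology, hence the usual notions of open, bounded, derivative and uniform
   limit, but metric quantities have to use the Euclidean norm [enorm]. *)
Section Euclidean.
Variables (R : realType) (d : nat).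
Local Notation V := 'rV[R]_d.

Definition enorm (x : V) : R := Num.sqrt (\sum_(i < d) x ord0 i ^+ 2).

(* Operator norms.  Matrices act on row vectors from the right, as for the
   library Jacobian: 'D_v f x = v *m 'J f x. *)
Definition opnorm (A : 'M[R]_d) : R :=
  sup [set enorm (v *m A) | v in [set v | enorm v <= 1]].

(* [B] is a bilinear map V * V -> V in the form (u, v) |-> v *m B u. *)
Definition opnorm2 (B : V -> 'M[R]_d) : R :=
  sup [set enorm (w.2 *m B w.1) | w in [set w : V * V | enorm w.1 <= 1 /\ enorm w.2 <= 1]].

Definition D2 (f : V -> V) (x : V) : V -> 'M[R]_d :=
  'd (fun y => 'J f y : 'M[R]_d) x.

Definition grad (u : V -> R) (x : V) : V :=
  \row_(i < d) 'D_(delta_mx ord0 i) u x.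

(* nabla log ||Df|| *)
Definition grad_log_D (f : V -> V) : V -> V :=
  grad (fun y => ln (opnorm ('J f y))).

Definition esup_on (A : set V) (F : V -> R) : \bar R :=
  ereal_sup [set (F x)%:E | x in A].

Definition is_domain (A : set V) : Prop := [/\ A !=set0, open A & connected A].

Definition frontier (A : set V) : set V := closure A `\` interior A.

End Euclidean.

(* R^d \cup {infinity}: [Some x] is a finite point, [None] is infinity. *)
Notation extended_space R d := (one_point_compactification 'rV[R]_d).

Section Moebius.
Variables (R : realType) (d : nat).
Local Notation V := 'rV[R]_d.
Local Notation Vh := (extended_space R d).

Definition similarity (lambda : R) (O : 'M[R]_d) (b : V) (p : Vh) : Vh :=
  if p is Some x then Some (lambda *: (x *m O) + b) else None.

Definition inversion (c : V) (r : R) (p : Vh) : Vh :=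
  if p is Some x then
    if x == c then None
    else Some (c + (r ^+ 2 / enorm (x - c) ^+ 2) *: (x - c))
  else Some c.

Definition is_similarity (f : Vh -> Vh) : Prop :=
  exists (lambda : R) (O : 'M[R]_d) (b : V),
    [/\ 0 < lambda, O *m O^T = 1%:M & f = similarity lambda O b].

Inductive moebius : (Vh -> Vh) -> Prop :=
| moebius_similarity f : is_similarity f -> moebius f
| moebius_inversion c r : 0 < r -> moebius (inversion c r)
| moebius_comp f g : moebius f -> moebius g -> moebius (f \o g).

(* The map induced on R^d; the value 0 is used only at the pole of [f]. *)
Definition finite_part (f : Vh -> Vh) (x : V) : V :=
  if f (Some x) is Some y then y else 0.

(* The pole f^{-1}(infinity) of a bijection f of R^d \cup {infinity}. *)
Definition pole (f : Vh -> Vh) : Vh := 'pinv_(fun=> None) setT f None.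

Definition point_dist (p : Vh) (A : set V) : \bar R :=
  if p is Some x then ereal_inf [set (enorm (x - y))%:E | y in A] else +oo%E.

Definition set_dist (A B : set V) : \bar R :=
  ereal_inf [set point_dist (Some x) B | x in A].

End Moebius.

Inductive word (N : nat) : Type :=
| Fin of seq 'I_N
| Inf of (nat -> 'I_N).

(* [None] is the length of an infinite word. *)
Definition word_length N (w : word N) : option nat :=
  match w with Fin s => Some (size s) | Inf _ => None end.

Definition first_letter N (w : word N) : option 'I_N :=
  match w with Fin s => ohead s | Inf u => Some (u 0%N) end.

Definition Z N : set (word N * word N) :=
  [set w | [/\ word_length w.1 = word_length w.2,
               word_length w.1 <> Some 0%N &
               first_letter w.1 <> first_letter w.2]].

Section IFS.
Variables (R : realType) (d N : nat) (Omega Omega' : set 'rV[R]_d).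
Local Notation V := 'rV[R]_d.
Local Notation Vh := (extended_space R d).
Implicit Types Phi Psi : 'I_N -> Vh -> Vh.

(* A conformal map of Omega' is identified with the Moebius transformation of
   which it is the restriction, so a system is a tuple of Moebius
   transformations without poles in Omega'. *)
Definition is_cifs Phi : Prop := forall i,
  [/\ moebius (Phi i),
      forall x, Omega' x -> Phi i (Some x) <> None,
      finite_part (Phi i) @` closure Omega `<=` Omega &
      forall x, closure Omega x -> opnorm ('J (finite_part (Phi i)) x) < 1].

Definition C2_dist (f g : V -> V) : \bar R :=
  adde (adde
    (esup_on (closure Omega) (fun x => enorm (f x - g x)))
    (esup_on (closure Omega) (fun x => opnorm ('J f x - 'J g x))))
    (esup_on (closure Omega) (fun x => opnorm2 (fun u => D2 f x u - D2 g x u))).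

Definition d2 Phi Psi : \bar R :=
  \big[maxe/-oo%E]_(i < N) C2_dist (finite_part (Phi i)) (finite_part (Psi i)).

Definition d2_closure (A : set ('I_N -> Vh -> Vh)) : set ('I_N -> Vh -> Vh) :=
  [set Phi | is_cifs Phi /\
     forall e : R, 0 < e -> exists2 Psi, A Psi & (d2 Phi Psi < e%:E)%E].

(* i_1 ... i_n |-> phi_{i_n} \o ... \o phi_{i_1} *)
Definition word_map Phi (s : seq 'I_N) : Vh -> Vh :=
  foldl (fun f i => Phi i \o f) id s.

Definition T_fin Phi (s : seq 'I_N) : V -> V :=
  grad_log_D (finite_part (word_map Phi s)).

(* The uniform limit on the closure of Omega; it is determined there only, and
   its other values are never used. *)
Definition T_inf Phi (u : nat -> 'I_N) : V -> V :=
  xget (fun=> 0)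
    [set f : V -> V |
      {uniform closure Omega, (fun n => T_fin Phi (mkseq u n)) @ \oo --> f}].

Definition T Phi (w : word N) : V -> V :=
  match w with Fin s => T_fin Phi s | Inf u => T_inf Phi u end.

Definition G_T : set ('I_N -> Vh -> Vh) :=
  [set Phi | is_cifs Phi /\
     (0 < ereal_inf [set esup_on (closure Omega)
                           (fun x => enorm (T Phi w.1 x - T Phi w.2 x)%R)
                    | w in @Z N])%E].

(* The suprema and infima below are taken in the extended reals; those passed
   to [fine] are finite for the systems to which they are applied. *)
Definition lambda_max Phi : R :=
  fine (\big[maxe/-oo%E]_(i < N)
    esup_on (closure Omega) (fun x => opnorm ('J (finite_part (Phi i)) x))).

Definition C_0 Phi : R :=
  2 / (1 - lambda_max Phi) *
  fine (\big[maxe/-oo%E]_(i < N)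
    esup_on (closure Omega) (fun x => enorm (grad_log_D (finite_part (Phi i)) x))).

Definition rho_Phi Phi : \bar R :=
  \big[mine/+oo%E]_(i < N)
    set_dist (finite_part (Phi i) @` closure Omega) (frontier Omega).

Definition rho_b Phi : R :=
  fine (mine (\big[mine/+oo%E]_(i < N) point_dist (Phi i None) (frontier Omega))
             (rho_Phi Phi)).

Definition R_pole Phi : R :=
  fine (ereal_sup [set point_dist (pole (word_map Phi s)) (closure Omega)
                  | s in [set s | s <> [::]]]).

Definition K_const Phi : R :=
  R_pole Phi ^+ 2 / Num.max (rho_b Phi) (2 / C_0 Phi) ^+ 2.

End IFS.

(* Main.v *)
Require Import Defs.
From HB Require Import structures.
From mathcomp Require Import all_boot all_order all_algebra.
From mathcomp Require Import all_classical all_reals all_analysis.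
From mathcomp Require Import ring lra.
Import Order.TTheory GRing.Theory Num.Theory.
Import numFieldNormedType.Exports.
Local Open Scope classical_set_scope.
Local Open Scope ring_scope.

(* A non-similar Moebius map f has a finite pole p = f^-1(oo) and
   |Df(x)| = k/|x-p|^2, so T_w(x) = -2 (x - p_w)/|x - p_w|^2 is determined by the
   pole p_w of the word map f_w: it suffices to separate, uniformly, the poles of
   words with different first letters.  Replace phi_i by phi_i(. - s_i), which
   replaces g_i by g_i + s_i.  Writing p_w = g_(w1)(g_(w2)(... oo)) and telescoping,
   p_w moves by s_(w1) up to an error at most lambda K/(1 - lambda) max |s_i| < max |s_i|,
   because g_(w1..wn) contracts by lambda^n K at the poles.  Hence for a <> b the
   difference of two poles with first letters a and b is expanding along the
   direction (s_a, s_b) = (v, -v).  Poles of words with the same prefix of length n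
   are O(lambda^n)-close, so a grid of mesh of order lambda^n for (s_i) has at most
   one bad point on each line in that direction, for each of the N^(2n) pairs
   of prefixes; as N^2 lambda^d < 1, some grid point is good for all pairs. *)

Set Implicit Arguments.
Unset Strict Implicit.
Unset Printing Implicit Defensive.

(** * Euclidean geometry and inversion in the unit sphere *)

(** Comparing two perturbed systems interpolates through words whose letters carry unrelated
    translations, whereas the constant R only controls the poles of the given system. The bound is
    therefore bootstrapped: telescoping needs nearness of poles to the closure only for prefixes of
    one of the two words. Taking that word with zero translations gives the bound R + t for all
    mixed words, once the translations are small compared with t.

    The denominator of K bounds from below the distance between the pole of one word and the image
    of infinity under another. Such a bound has two sources. Images of infinity stay rho_b inside
    Omega, and poles lie outside. Independently, a geometric series keeps poles at distance D(1 -
    lambda) from the closure, where D is the least distance of a generator pole; 2/C_0 is half of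
    this, and the factor two is room for the perturbation. The other strict inequalities are relaxed
    by the same small t. *)

Section EuclideanSpace.
Variables (R : realType) (d : nat).
Local Notation V := 'rV[R]_d.
Implicit Types (x y z u v w a : V) (O : 'M[R]_d).

Definition dot x y : R := \sum_(i < d) x ord0 i * y ord0 i.

Lemma dotE x y : dot x y = (x *m y^T) ord0 ord0.
Proof. by rewrite mxE; apply: eq_bigr => i _; rewrite mxE. Qed.

Lemma dotC x y : dot x y = dot y x.
Proof. by apply: eq_bigr => i _; rewrite mulrC. Qed.

Lemma dotDl x y z : dot (x + y) z = dot x z + dot y z.
Proof. by rewrite !dotE mulmxDl mxE. Qed.

Lemma dotZl c x y : dot (c *: x) y = c * dot x y.
Proof. by rewrite !dotE -scalemxAl mxE. Qed.

Lemma dotNl x y : dot (- x) y = - dot x y.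
Proof. by rewrite -scaleN1r dotZl mulN1r. Qed.

Lemma dotBl x y z : dot (x - y) z = dot x z - dot y z.
Proof. by rewrite dotDl dotNl. Qed.

Lemma dotDr x y z : dot x (y + z) = dot x y + dot x z.
Proof. by rewrite dotC dotDl !(dotC x). Qed.

Lemma dotZr c x y : dot x (c *: y) = c * dot x y.
Proof. by rewrite dotC dotZl dotC. Qed.

Lemma dotNr x y : dot x (- y) = - dot x y.
Proof. by rewrite dotC dotNl dotC. Qed.

Lemma dotBr x y z : dot x (y - z) = dot x y - dot x z.
Proof. by rewrite dotDr dotNr. Qed.

Lemma dot0l x : dot 0 x = 0.
Proof. by rewrite -(scale0r 0) dotZl mul0r. Qed.

Lemma dot0r x : dot x 0 = 0.
Proof. by rewrite dotC dot0l. Qed.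

Definition dot_lin := (dotDl, dotBl, dotZl, dotNl, dotDr, dotBr, dotZr, dotNr).

Lemma dot_ge0 x : 0 <= dot x x.
Proof. by apply: sumr_ge0 => i _; rewrite -expr2 sqr_ge0. Qed.

Lemma dot_eq0 x : (dot x x == 0) = (x == 0).
Proof.
apply/idP/eqP => [|->]; last by rewrite dot0l.
rewrite psumr_eq0 => [/allP h|i _]; last by rewrite -expr2 sqr_ge0.
apply/rowP => i; rewrite mxE; apply/eqP.
by have := h i (mem_index_enum _); rewrite /= -expr2 sqrf_eq0.
Qed.

Lemma dot_gt0 x : x != 0 -> 0 < dot x x.
Proof. by rewrite lt_def dot_ge0 dot_eq0 => ->. Qed.

Lemma dot_mulmx O x y : O *m O^T = 1%:M -> dot (x *m O) (y *m O) = dot x y.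
Proof. by move=> hO; rewrite !dotE trmx_mul mulmxA -(mulmxA x) hO mulmx1. Qed.

Lemma enormE x : enorm x = Num.sqrt (dot x x).
Proof. by congr Num.sqrt; apply: eq_bigr => i _; rewrite expr2. Qed.

Lemma enorm_sqr x : enorm x ^+ 2 = dot x x.
Proof. by rewrite enormE sqr_sqrtr ?dot_ge0. Qed.

Lemma enorm_ge0 x : 0 <= enorm x.
Proof. exact: sqrtr_ge0. Qed.

Lemma enorm0 : enorm (0 : V) = 0.
Proof. by rewrite enormE dot0l sqrtr0. Qed.

Lemma enorm_eq0 x : (enorm x == 0) = (x == 0).
Proof. by rewrite -dot_eq0 -enorm_sqr sqrf_eq0. Qed.

Lemma enorm_gt0 x : (0 < enorm x) = (x != 0).
Proof. by rewrite lt_def enorm_ge0 enorm_eq0 andbT. Qed.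

Lemma enormN x : enorm (- x) = enorm x.
Proof. by rewrite !enormE dotNl dotNr opprK. Qed.

Lemma enormB x y : enorm (x - y) = enorm (y - x).
Proof. by rewrite -enormN opprB. Qed.

Lemma enormZ c x : enorm (c *: x) = `|c| * enorm x.
Proof. by rewrite !enormE dotZl dotZr mulrA -expr2 sqrtrM ?sqr_ge0// sqrtr_sqr. Qed.

Lemma enorm_mulmx O x : O *m O^T = 1%:M -> enorm (x *m O) = enorm x.
Proof. by move=> hO; rewrite !enormE dot_mulmx. Qed.

Lemma dot_le_enorm x y : dot x y <= enorm x * enorm y.
Proof.
have [->|x0] := eqVneq x 0; first by rewrite dot0l enorm0 mul0r.
have [->|y0] := eqVneq y 0; first by rewrite dot0r enorm0 mulr0.
have hx : 0 < enorm x by rewrite enorm_gt0.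
have hy : 0 < enorm y by rewrite enorm_gt0.
have := dot_ge0 (enorm y *: x - enorm x *: y).
rewrite !dot_lin -!enorm_sqr (dotC y x) => h.
have {h} : 0 <= 2 * (enorm x * enorm y) * (enorm x * enorm y - dot x y) by nra.
by rewrite pmulr_rge0 ?subr_ge0// !mulr_gt0.
Qed.

Lemma ler_enormD x y : enorm (x + y) <= enorm x + enorm y.
Proof.
rewrite -ler_sqr ?nnegrE ?addr_ge0 ?enorm_ge0// enorm_sqr !dot_lin (dotC y x).
by have := dot_le_enorm x y; rewrite -!enorm_sqr; nra.
Qed.

Lemma ler_enormB x y : enorm (x - y) <= enorm x + enorm y.
Proof. by rewrite (le_trans (ler_enormD _ _))// enormN. Qed.

Lemma ler_enorm_dist y x z : enorm (x - z) <= enorm (x - y) + enorm (y - z).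
Proof. by have := ler_enormD (x - y) (y - z); rewrite addrA subrK. Qed.

Lemma coord_le_enorm x i : `|x ord0 i| <= enorm x.
Proof.
rewrite -(ger0_norm (enorm_ge0 x)) -ler_sqr ?nnegrE// !real_normK ?num_real//.
rewrite enorm_sqr /dot (bigD1 i)//= -expr2 lerDl sumr_ge0// => j _.
by rewrite -expr2 sqr_ge0.
Qed.

Lemma enorm_le_sum x : enorm x <= \sum_(i < d) `|x ord0 i|.
Proof.
have s0 : 0 <= \sum_(i < d) `|x ord0 i| by apply: sumr_ge0 => i _.
rewrite -ler_sqr ?nnegrE ?enorm_ge0// enorm_sqr expr2 mulr_suml /dot.
apply: ler_sum => i _; rewrite (le_trans (ler_norm _))// normrM ler_wpM2l//.
by rewrite (bigD1 i)//= lerDl sumr_ge0.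
Qed.

(** With [enorm_le_mxnorm], this carries topological notions, built on the maximum norm, over to
    Euclidean estimates. *)
Lemma mxnorm_le_enorm x : `|x| <= enorm x.
Proof.
rewrite /Num.norm/= mx_normrE; apply: bigmax_le => [|[i j] _]; first exact: enorm_ge0.
by rewrite /= (ord1 i) coord_le_enorm.
Qed.

Lemma enorm_le_mxnorm x : enorm x <= d%:R * `|x|.
Proof.
apply: le_trans (enorm_le_sum x) _.
apply: (@le_trans _ _ (\sum_(i < d) `|x|)).
  apply: ler_sum => i _; rewrite [leRHS]/Num.norm/= mx_normrE.
  exact: (le_bigmax _ (fun ij : 'I_1 * 'I_d => `|x ij.1 ij.2|) (ord0, i)).
by rewrite sumr_const card_ord mulr_natl.
Qed.

(** The convention [0^-1 = 0] gives the value 0 at 0, so that the involution, scaling and norm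
    identities hold without excluding 0. The true value, infinity, is handled by [invmap]. *)
Definition sphinv z : V := (dot z z)^-1 *: z.

Lemma sphinv0 : sphinv 0 = 0.
Proof. by rewrite /sphinv scaler0. Qed.

Lemma dot_sphinv z : dot (sphinv z) (sphinv z) = (dot z z)^-1.
Proof.
have [->|z0] := eqVneq z 0; first by rewrite sphinv0 dot0l invr0.
by rewrite !dot_lin; field; rewrite dot_eq0.
Qed.

Lemma sphinvK : involutive sphinv.
Proof.
move=> z; have [->|z0] := eqVneq z 0; first by rewrite !sphinv0.
by rewrite {1}/sphinv dot_sphinv invrK scalerA divff ?dot_eq0// scale1r.
Qed.

Lemma sphinv_eq0 z : (sphinv z == 0) = (z == 0).
Proof. by rewrite -dot_eq0 dot_sphinv invr_eq0 dot_eq0. Qed.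

Lemma sphinvZ c z : sphinv (c *: z) = c^-1 *: sphinv z.
Proof.
have [->|c0] := eqVneq c 0; first by rewrite invr0 !scale0r sphinv0.
have [->|z0] := eqVneq z 0; first by rewrite scaler0 sphinv0 scaler0.
rewrite /sphinv !dot_lin !scalerA; congr (_ *: z).
by field; rewrite dot_eq0 z0 c0.
Qed.

Lemma sphinvM O z : O *m O^T = 1%:M -> sphinv (z *m O) = sphinv z *m O.
Proof. by move=> hO; rewrite /sphinv dot_mulmx// scalemxAl. Qed.

Lemma enorm_sphinv z : enorm (sphinv z) = (enorm z)^-1.
Proof. by rewrite !enormE dot_sphinv sqrtrV ?dot_ge0. Qed.

(** This exact distortion identity is the source of the contraction, distance and separation
    estimates for Moebius maps below. *)
Lemma enorm_sphinvB z w : z != 0 -> w != 0 ->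
  enorm (sphinv z - sphinv w) = enorm (z - w) / (enorm z * enorm w).
Proof.
move=> z0 w0; rewrite !enormE -sqrtrM ?dot_ge0// -sqrtrV ?mulr_ge0 ?dot_ge0//.
rewrite -sqrtrM ?dot_ge0//; congr Num.sqrt; rewrite !dot_lin (dotC w z).
by field; rewrite !dot_eq0 z0 w0.
Qed.

(** Reflection in the hyperplane orthogonal to [a]; divided by |a|^2 it is the derivative of
    [sphinv] at [a]. *)
Definition reflection a : 'M[R]_d := 1%:M - (2 / dot a a) *: (a^T *m a).

Lemma mul_reflection a v : v *m reflection a = v - (2 * dot v a / dot a a) *: a.
Proof.
rewrite mulmxBr mulmx1 -scalemxAr mulmxA; congr (_ - _).
have -> : v *m a^T = (dot v a)%:M by rewrite [LHS]mx11_scalar -dotE.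
by rewrite mul_scalar_mx scalerA mulrAC.
Qed.

Lemma reflection_orth a : a != 0 -> reflection a *m (reflection a)^T = 1%:M.
Proof.
move=> a0; have -> : (reflection a)^T = reflection a.
  by rewrite /reflection linearB /= linearZ /= trmx1 trmx_mul trmxK.
have da : dot a a != 0 by rewrite dot_eq0.
set t := (a *m a^T) ord0 ord0; set P := a^T *m a.
have PP : P *m P = t *: P.
  by rewrite /P mulmxA -(mulmxA a^T) [a *m a^T]mx11_scalar -scalemx1 -scalemxAr
    mulmx1 -scalemxAl.
have t0 : t != 0 by rewrite /t -dotE dot_eq0.
rewrite /reflection dotE -/t -/P mulmxBl mul1mx mulmxBr mulmx1 -scalemxAl -scalemxAr PP.
apply/matrixP => i j; rewrite !mxE; field; exact: t0.
Qed.

(* In complex notation: 1/(1/z + a) = 1/a - a^-2/(z + 1/a). *)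
Lemma sphinv_shift a z : a != 0 -> z != 0 -> z + sphinv a != 0 ->
  sphinv (sphinv z + a) =
  sphinv a + (dot a a)^-1 *: (sphinv (z + sphinv a) *m reflection a).
Proof.
move=> a0 z0 za0.
have da : dot a a != 0 by rewrite dot_eq0.
have dz : dot z z != 0 by rewrite dot_eq0.
have dza : dot (z + sphinv a) (z + sphinv a) != 0 by rewrite dot_eq0.
have E1 : dot (z + sphinv a) (z + sphinv a) =
    (1 + 2 * dot z a + dot z z * dot a a) / dot a a.
  by rewrite !dot_lin (dotC a z); field.
have E2 : dot (sphinv z + a) (sphinv z + a) =
    (1 + 2 * dot z a + dot z z * dot a a) / dot z z.
  by rewrite !dot_lin (dotC a z); field.
have D0 : 1 + 2 * dot z a + dot z z * dot a a != 0.
  by apply: contraNneq dza => h; rewrite E1 h mul0r.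
rewrite mul_reflection; apply/rowP => j.
rewrite {1 4}/sphinv !dotZl E1 E2 !dot_lin !mxE.
by field; rewrite D0 da dz.
Qed.

End EuclideanSpace.

(** * Normal form of Moebius maps *)

Section MoebiusNormalForm.
Variables (R : realType) (d : nat).
Local Notation V := 'rV[R]_d.
Local Notation Vh := (extended_space R d).
Implicit Types (b c p s x y : V) (k : R) (O Q : 'M[R]_d) (f g : Vh -> Vh).

(** Normal form of a Moebius map that moves infinity: [p] is its pole, [b] the image of infinity,
    and [k] its squared radius of inversion. Inverting the map exchanges [b] and [p] and transposes
    [O]. *)
Definition invmap b k p O : Vh -> Vh := fun q =>
  if q is Some x then
    if x == p then None else Some (b + k *: (sphinv (x - p) *m O))
  else Some b.

Lemma invmap_pole b k p O : invmap b k p O (Some p) = None.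
Proof. by rewrite /invmap eqxx. Qed.

Lemma invmap_fin b k p O x : x != p ->
  invmap b k p O (Some x) = Some (b + k *: (sphinv (x - p) *m O)).
Proof. by move=> /negbTE xp; rewrite /invmap xp. Qed.

Lemma invmapK b k p O : 0 < k -> O *m O^T = 1%:M ->
  cancel (invmap b k p O) (invmap p k b O^T).
Proof.
move=> k0 hO [x|]; last by rewrite /= eqxx.
have [->|xp] := eqVneq x p; first by rewrite invmap_pole.
have OO : sphinv (x - p) *m O *m O^T = sphinv (x - p).
  by rewrite -mulmxA hO mulmx1.
rewrite invmap_fin// invmap_fin.
  rewrite addrAC subrr add0r sphinvZ sphinvM// sphinvK -scalemxAl scalerA.
  by rewrite divff ?gt_eqF// scale1r -mulmxA hO mulmx1 addrC subrK.
rewrite addrC -subr_eq0 addrK scaler_eq0 gt_eqF//=.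
by rewrite -enorm_eq0 enorm_mulmx// enorm_eq0 sphinv_eq0 subr_eq0.
Qed.

Lemma mulmx_trC O : O *m O^T = 1%:M -> O^T *m (O^T)^T = 1%:M.
Proof. by move=> hO; rewrite trmxK (mulmx1C hO). Qed.

Lemma mulmx_orth O Q : O *m O^T = 1%:M -> Q *m Q^T = 1%:M ->
  (O *m Q) *m (O *m Q)^T = 1%:M.
Proof. by move=> hO hQ; rewrite trmx_mul mulmxA -(mulmxA O) hQ mulmx1. Qed.

Lemma invmapVK b k p O : 0 < k -> O *m O^T = 1%:M ->
  cancel (invmap p k b O^T) (invmap b k p O).
Proof.
by move=> k0 hO; have := invmapK p b k0 (mulmx_trC hO); rewrite trmxK.
Qed.

(** By [sphinv_shift] the two inversions merge into one. Only the ratio is made explicit: it has to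
    be estimated for words, while the centre and the pole of a word are recovered as the images of
    infinity under the map and its inverse. *)
Lemma invmap_comp b1 k1 p1 O1 b2 k2 p2 O2 : 0 < k1 -> 0 < k2 ->
  O1 *m O1^T = 1%:M -> O2 *m O2^T = 1%:M -> b1 != p2 ->
  exists b p O, O *m O^T = 1%:M /\
    invmap b2 k2 p2 O2 \o invmap b1 k1 p1 O1 =
    invmap b (k1 * k2 / enorm (b1 - p2) ^+ 2) p O.
Proof.
move=> k10 k20 h1 h2 bp; rewrite enorm_sqr; set a := b1 - p2.
have a0 : a != 0 by rewrite subr_eq0.
have da : dot a a != 0 by rewrite dot_eq0.
(* The first map sends [p1 - c] to [p2], so this point is the pole of the composition. *)
pose c := k1 *: (sphinv a *m O1^T).
have c0 : c != 0.
  rewrite scaler_eq0 gt_eqF//= -enorm_eq0 enorm_mulmx ?mulmx_trC//.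
  by rewrite enorm_eq0 sphinv_eq0.
exists (b2 + k2 *: (sphinv a *m O2)), (p1 - c), (O1 *m reflection a *m O2); split.
  by do 2?apply: mulmx_orth => //; exact: reflection_orth.
apply/funext => -[x|] /=; last by rewrite (negbTE bp).
have [->|xp] := eqVneq x p1.
  rewrite /= ifF; last by rewrite -subr_eq0 subKr (negbTE c0).
  rewrite subKr sphinvZ !sphinvM ?mulmx_trC// sphinvK.
  rewrite -!scalemxAl !scalerA.
  have -> : a *m O1^T *m (O1 *m reflection a *m O2) = - (a *m O2).
    rewrite !mulmxA -(mulmxA a) (mulmx1C h1) mulmx1 mul_reflection.
    by rewrite -mulrA divff// mulr1 -[X in X - _]scale1r -scalerBl
      (_ : 1 - 2 = -1 :> R) ?scaleN1r ?mulNmx//; ring.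
  congr Some; rewrite scalerN.
  rewrite (_ : k1 * k2 / dot a a / k1 = k2 / dot a a) ?addrK//.
  by field; rewrite da gt_eqF.
have z0 : x - p1 != 0 by rewrite subr_eq0.
have key : b1 + k1 *: (sphinv (x - p1) *m O1) - p2 =
    (sphinv (k1^-1 *: ((x - p1) *m O1)) + a).
  by rewrite sphinvZ invrK sphinvM// addrAC [RHS]addrC.
have sa : sphinv a = k1^-1 *: (c *m O1).
  rewrite /c -scalemxAl scalerA mulVf ?gt_eqF// scale1r -mulmxA (mulmx1C h1).
  by rewrite mulmx1.
have shift : k1^-1 *: ((x - p1) *m O1) + sphinv a =
    k1^-1 *: ((x - (p1 - c)) *m O1).
  by rewrite sa -scalerDr -mulmxDl opprB addrA addrAC.
have eq0 (v : V) : (k1^-1 *: (v *m O1) == 0) = (v == 0).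
  rewrite scaler_eq0 invr_eq0 gt_eqF//=. by rewrite -[LHS]enorm_eq0 enorm_mulmx// enorm_eq0.
have [xP|xP] := eqVneq x (p1 - c).
  rewrite {1}/invmap ifT// -subr_eq0 key.
  move: shift; rewrite xP subrr mul0mx scaler0 => /eqP.
  rewrite addr_eq0 => /eqP ->.
  have -> : - sphinv a = sphinv (- a) by rewrite /sphinv dotNl dotNr opprK scalerN.
  by rewrite sphinvK addNr.
have xP0 : x - (p1 - c) != 0 by rewrite subr_eq0.
rewrite {1}/invmap ifF; last first.
  apply/negbTE; rewrite -subr_eq0 key addr_eq0; apply: contra xP0 => /eqP h.
  rewrite -eq0 -shift -[X in X + _]sphinvK h /sphinv dotNl dotNr opprK scalerN.
  by rewrite addNr.
rewrite key sphinv_shift ?eq0 ?shift ?eq0// sphinvZ invrK sphinvM//.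
congr Some; rewrite mulmxDl scalerDr addrA; congr (_ + _).
rewrite -!scalemxAl !scalerA !mulmxA; congr (_ *: _).
by field; rewrite da dot_eq0 xP0.
Qed.

Lemma enorm_invmapB k p O x y : O *m O^T = 1%:M -> 0 < k -> x != p -> y != p ->
  enorm (k *: (sphinv (x - p) *m O) - k *: (sphinv (y - p) *m O)) =
  k * enorm (x - y) / (enorm (x - p) * enorm (y - p)).
Proof.
move=> hO k0 xp yp; rewrite -scalerBr -mulmxBl enormZ enorm_mulmx// gtr0_norm//.
by rewrite enorm_sphinvB ?subr_eq0// opprB addrA subrK mulrA.
Qed.

Lemma invmap_sim l Q c b k p O : 0 < l -> 0 < k ->
  Q *m Q^T = 1%:M -> O *m O^T = 1%:M ->
  invmap b k p O \o similarity l Q c =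
  invmap b (k / l) (l^-1 *: ((p - c) *m Q^T)) (Q *m O).
Proof.
move=> l0 k0 hQ hO; apply/funext => -[x|] //=.
have E : l *: (x *m Q) + c - p = l *: ((x - l^-1 *: ((p - c) *m Q^T)) *m Q).
  rewrite mulmxBl -scalemxAl -mulmxA (mulmx1C hQ) mulmx1 scalerBr scalerA.
  by rewrite divff ?gt_eqF// scale1r opprB addrA.
rewrite -subr_eq0 E scaler_eq0 gt_eqF//= -enorm_eq0 enorm_mulmx// enorm_eq0.
rewrite subr_eq0; case: ifP => // _.
by rewrite sphinvZ sphinvM// -scalemxAl scalerA mulmxA.
Qed.

Lemma sim_invmap l Q c b k p O :
  similarity l Q c \o invmap b k p O =
  invmap (l *: (b *m Q) + c) (l * k) p (O *m Q).
Proof.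
apply/funext => -[x|] //=; case: ifP => //= _; congr Some.
by rewrite mulmxDl scalerDr addrAC -scalemxAl scalerA mulmxA.
Qed.

Lemma inversion_invmap c r : inversion c r = invmap c (r ^+ 2) c 1%:M.
Proof.
apply/funext => -[x|] //=; case: ifP => //= _.
by rewrite mulmx1 /sphinv scalerA enorm_sqr.
Qed.

Lemma sim_comp f g : is_similarity f -> is_similarity g -> is_similarity (f \o g).
Proof.
move=> [l [Q [c [l0 hQ ->]]]] [m [S [e [m0 hS ->]]]].
exists (l * m), (S *m Q), (l *: (e *m Q) + c); split; rewrite ?mulr_gt0//.
  exact: mulmx_orth.
apply/funext => -[x|] //=; congr Some.
by rewrite mulmxDl scalerDr addrA -scalemxAl scalerA mulmxA.
Qed.

Lemma moebius_normal_form f : moebius f -> is_similarity f \/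
  exists b k p O, [/\ 0 < k, O *m O^T = 1%:M & f = invmap b k p O].
Proof.
elim=> [g|c r r0|{}f g _ IHf _ IHg]; first by left.
  right; exists c, (r ^+ 2), c, 1%:M.
  by rewrite exprn_gt0// trmx1 mulmx1 inversion_invmap.
case: IHf IHg => [sf|[b2 [k2 [p2 [ O2 [k20 h2 ->]]]]]].
  move=> [sg|[b [k [p [ O [k0 hO ->]]]]]]; first by left; exact: sim_comp.
  right; case: sf => [l [Q [c [l0 hQ ->]]]].
  exists (l *: (b *m Q) + c), (l * k), p, (O *m Q).
  by rewrite sim_invmap mulr_gt0//; split=> //; exact: mulmx_orth.
move=> [[l [Q [c [l0 hQ ->]]]]|[b1 [k1 [p1 [ O1 [k10 h1 ->]]]]]].
  right; rewrite invmap_sim//; do 4!eexists; split; last by [].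
    by rewrite divr_gt0.
  exact: mulmx_orth.
have [bp|bp] := eqVneq b1 p2; last first.
  right; have [b [p [ O [hO E]]]] := invmap_comp p1 b2 k10 k20 h1 h2 bp.
  exists b, (k1 * k2 / enorm (b1 - p2) ^+ 2), p, O; split; last exact: E; last by [].
  by rewrite divr_gt0 ?(mulr_gt0 k10 k20)// exprn_gt0// enorm_gt0 subr_eq0.
(* Here [b1 = p2], the composition fixes infinity, and the two inversions cancel by [sphinvK] up to
   a similarity. *)
left; exists (k2 / k1), (O1 *m O2), (b2 - (k2 / k1) *: (p1 *m O1 *m O2)).
split; [by rewrite divr_gt0|exact: mulmx_orth|].
apply/funext => -[x|] /=; last by rewrite bp eqxx.
have [->|xp] := eqVneq x p1; first by rewrite mulmxA addrC subrK.
have z0 : k1 *: (sphinv (x - p1) *m O1) != 0.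
  rewrite scaler_eq0 gt_eqF//= -enorm_eq0 enorm_mulmx// enorm_eq0 sphinv_eq0.
  by rewrite subr_eq0.
rewrite bp invmap_fin; last by rewrite addrC -subr_eq0 addrK.
rewrite [p2 + _]addrC addrK; congr Some.
rewrite sphinvZ sphinvM// sphinvK -scalemxAl scalerA !mulmxBl scalerBr mulmxA.
by rewrite addrCA.
Qed.

Lemma pole_invmap b k p O : pole (invmap b k p O) = Some p.
Proof.
have : invmap b k p O (pole (invmap b k p O)) = None.
  by apply: pinvK; rewrite inE; exists (Some p) => //; exact: invmap_pole.
by move: (pole _) => [x|//] /=; case: eqVneq => [->|].
Qed.

End MoebiusNormalForm.

(** * Derivatives of Moebius maps *)

Section Differentials.
Variables (R : realType) (V W : normedModType R).
Implicit Type x : V.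

(** [finite_part] of an [invmap] agrees with its smooth formula only off the pole, so differentials
    have to be transferred along equality near a point. *)
Lemma near_eq_is_diff (f g dg : V -> W) (x : V) :
  (\forall y \near x, f y = g y) -> is_diff x g dg -> is_diff x f dg.
Proof.
move=> fg dgx.
have fgx : f x = g x by exact: (nbhs_singleton fg).
have cg : continuous ('d g x) by exact: diff_continuous.
have E : f \o shift x = cst (f x) + 'd g x +o_ 0 id.
  apply/eqaddoP => e e0.
  have /eqaddoP/(_ e e0) h : g \o shift x = cst (g x) + 'd g x +o_ 0 id.
    exact: diff_locally.
  have fg0 : \forall y \near (0 : V), f (y + x) = g (y + x).
    by move: fg; rewrite (near_shift 0 x) subr0.
  apply: filterS2 h fg0 => y h fgy.
  by move: h; rewrite /= !fctE /= fgx fgy.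
have D := diff_unique cg E.
apply: DiffDef; first by apply/diff_locallyP; rewrite D.
by rewrite D; exact: diff_val.
Qed.

Lemma is_diff_addf (f g df dg : V -> W) x : is_diff x f df -> is_diff x g dg ->
  is_diff x (fun y => f y + g y) (fun v => df v + dg v).
Proof. by move=> hf hg; exact: is_diffD. Qed.

Lemma is_diff_csts (a : W) x : is_diff x (fun=> a) (fun=> 0 : W).
Proof. exact: is_diff_cst. Qed.

Lemma is_diff_sumf (I : Type) (r : seq I) (f df : I -> V -> W) x :
  (forall i, is_diff x (f i) (df i)) ->
  is_diff x (fun y => \sum_(i <- r) f i y) (fun v => \sum_(i <- r) df i v).
Proof.
move=> h; elim: r => [|i r IH].
  under eq_fun do rewrite big_nil; under [X in is_diff _ _ X]eq_fun do rewrite big_nil.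
  exact: is_diff_csts.
under eq_fun do rewrite big_cons; under [X in is_diff _ _ X]eq_fun do rewrite big_cons.
exact: is_diff_addf.
Qed.

Lemma is_diff_scalef (f df : V -> R) (w : W) x : is_diff x f df ->
  is_diff x (fun y => f y *: w) (fun v => df v *: w).
Proof.
move=> hf; exact: (@is_diff_comp _ _ _ _ f df ( *:%R ^~ w) ( *:%R ^~ w) x hf
  (is_diff_scalel _ _)).
Qed.

Lemma is_diff_mulf (f g df dg : V -> R) x : is_diff x f df -> is_diff x g dg ->
  is_diff x (fun y => f y * g y) (fun v => f x * dg v + g x * df v).
Proof. by move=> hf hg; exact: is_diffM. Qed.

Lemma is_diff_invf (f df : V -> R) x : is_diff x f df -> f x != 0 ->
  is_diff x (fun y => (f y)^-1) (fun v => - (f x) ^- 2 * df v).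
Proof.
move=> hf fx0; apply: DiffDef; first exact: differentiableV.
by rewrite diffV// diff_val.
Qed.

End Differentials.

Section MatrixDifferentials.
Variables (R : realType) (V : normedModType R) (m n : nat).

Lemma is_diff_mx (h dh : V -> 'M[R]_(m, n)) x :
  (forall i j, is_diff x (fun y => h y i j) (fun v => dh v i j)) -> is_diff x h dh.
Proof.
move=> H.
have -> : h = fun y => \sum_(i < m) \sum_(j < n) h y i j *: delta_mx i j.
  by apply/funext => y; exact: matrix_sum_delta.
have -> : dh = fun v => \sum_(i < m) \sum_(j < n) dh v i j *: delta_mx i j.
  by apply/funext => y; exact: matrix_sum_delta.
by do 2!apply: is_diff_sumf => ?; exact: is_diff_scalef.
Qed.

End MatrixDifferentials.

Section InvmapDifferential.
Variables (R : realType) (d : nat).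
Local Notation V := 'rV[R]_d.
Local Notation Vh := (extended_space R d).
Implicit Types (b p x y u v : V) (k : R) (O : 'M[R]_d).

Lemma is_diff_coordB p i x :
  is_diff x (fun y : V => (y - p) ord0 i) (fun v : V => v ord0 i).
Proof.
have h : is_diff x (fun y : V => y ord0 i) (fun v : V => v ord0 i).
  have cc : continuous (fun y : V => y ord0 i) by exact: coord_continuous.
  have lc : linear (fun y : V => y ord0 i : R^o) by move=> a u v; rewrite !mxE.
  pose cM := GRing.isLinear.Build _ _ _ _ _ lc.
  pose c : {linear V -> R^o} := HB.pack (fun y : V => y ord0 i : R^o) cM.
  apply: DiffDef; first exact: differentiable_coord.
  exact: (diff_lin (f := c)).
have := is_diff_addf h (@is_diff_csts R V R (- p ord0 i) x).
rewrite (_ : (fun v => _ + 0) = fun v : V => v ord0 i); last first.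
  by apply/funext => v; rewrite addr0.
by congr (is_diff _ _ _); apply/funext => y; rewrite !mxE.
Qed.

(** The conformal factor of the unit inversion with pole [p]. *)
Definition qinv p y : R := (dot (y - p) (y - p))^-1.
Definition dqinv p x v : R := - 2 * qinv p x ^+ 2 * dot (x - p) v.

Lemma is_diff_dotB p x : is_diff x (fun y => dot (y - p) (y - p))
  (fun v => 2 * dot (x - p) v).
Proof.
rewrite (_ : (fun v => 2 * dot (x - p) v) = fun v => \sum_i ((x - p) ord0 i * v ord0 i +
    (x - p) ord0 i * v ord0 i)).
  apply: (@is_diff_sumf R V R _ _ (fun i y => (y - p) ord0 i * (y - p) ord0 i)
    (fun i v => (x - p) ord0 i * v ord0 i + (x - p) ord0 i * v ord0 i)) => i.
  by apply: is_diff_mulf; exact: is_diff_coordB.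
by apply/funext => v; rewrite big_split/= -mulr2n mulr_natl.
Qed.

Lemma is_diff_qinv p x : x != p -> is_diff x (qinv p) (dqinv p x).
Proof.
move=> xp; rewrite (_ : dqinv p x =
    fun v => - (dot (x - p) (x - p)) ^- 2 * (2 * dot (x - p) v)).
  by apply: is_diff_invf; [exact: is_diff_dotB|rewrite dot_eq0 subr_eq0].
by apply/funext => v; rewrite /dqinv /qinv exprVn; ring.
Qed.

Definition invmap_jac k p O x : 'M[R]_d :=
  (k * qinv p x) *: (reflection (x - p) *m O).

Lemma finite_part_invmap b k p O x : x != p ->
  finite_part (invmap b k p O) x = b + k *: (sphinv (x - p) *m O).
Proof. by move=> xp; rewrite /finite_part invmap_fin. Qed.

Lemma near_neq p x : x != p -> \forall y \near x, y != p.
Proof.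
move=> xp; have : nbhs x (~` [set p]).
  apply: open_nbhs_nbhs; split; last exact/eqP.
  apply/closed_openC/accessible_closed_set1/hausdorff_accessible.
  exact: norm_hausdorff.
by apply: filterS => y /eqP.
Qed.

Lemma jacobianE (f : V -> V) (A : 'M[R]_d) x : is_diff x f (mulmx^~ A) -> 'J f x = A.
Proof.
move=> h; apply/row_matrixP => i.
rewrite !rowE mul_rV_lin1; exact: (congr1 (@^~ _) (diff_val (is_diff_def := h))).
Qed.

Lemma is_diff_invmap b k p O x : x != p ->
  is_diff x (finite_part (invmap b k p O)) (mulmx^~ (invmap_jac k p O x)).
Proof.
move=> xp; apply: (@near_eq_is_diff _ _ _ _
    (fun y => b + k *: (sphinv (y - p) *m O))).
  by apply: filterS (near_neq xp) => y; exact: finite_part_invmap.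
apply: is_diff_mx => i j; rewrite (ord1 i).
have := @is_diff_addf R V R _ _ _ _ _ (@is_diff_csts R V R (b ord0 j) x)
  (@is_diff_sumf R V R _ (index_enum 'I_d) _ _ x
    (fun l => is_diff_mulf (@is_diff_csts R V R (k * O l j) x)
       (is_diff_mulf (is_diff_qinv xp) (is_diff_coordB p l x)))).
set F := (X in is_diff _ X _ -> _); set dF := (X in is_diff _ _ X -> _).
rewrite (_ : F = fun y => (b + k *: (sphinv (y - p) *m O)) ord0 j); last first.
  apply/funext => y; rewrite /F !mxE mulr_sumr; congr (_ + _).
  by apply: eq_bigr => l _; rewrite !mxE /qinv; ring.
rewrite (_ : dF = fun v => (v *m invmap_jac k p O x) ord0 j)//.
apply/funext => v; rewrite /dF add0r /invmap_jac -scalemxAr mulmxA mul_reflection.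
rewrite !mxE mulr_sumr; apply: eq_bigr => l _; rewrite !mxE /dqinv (dotC v) /qinv.
by ring.
Qed.

Lemma jacobian_invmap b k p O x : x != p ->
  'J (finite_part (invmap b k p O)) x = invmap_jac k p O x.
Proof. by move=> xp; apply: jacobianE; exact: is_diff_invmap. Qed.

(** The product rule applied to [invmap_jac] with the reflection written out. The entries stay
    finite sums of products, so that they can be bounded by closure properties of Lipschitz
    functions. *)
Definition invmap_jac2 k p O x u : 'M[R]_d := \matrix_(i, j) \sum_l
  (k * O l j) * ((i == l)%:R * dqinv p x u - 2 * (2 * qinv p x * dqinv p x u *
    ((x - p) ord0 i * (x - p) ord0 l) + qinv p x ^+ 2 *
    ((x - p) ord0 i * u ord0 l + (x - p) ord0 l * u ord0 i))).

Lemma D2_invmap b k p O x u : x != p ->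
  D2 (finite_part (invmap b k p O)) x u = invmap_jac2 k p O x u.
Proof.
move=> xp; suff h : is_diff x (fun y => 'J (finite_part (invmap b k p O)) y : 'M[R]_d)
    (invmap_jac2 k p O x).
  exact: (congr1 (@^~ _) (diff_val (is_diff_def := h))).
apply: (@near_eq_is_diff _ _ _ _ (invmap_jac k p O)).
  by apply: filterS (near_neq xp) => y; exact: jacobian_invmap.
apply: is_diff_mx => i j.
have hq := is_diff_qinv xp; have hz := is_diff_coordB p ^~ x.
have := @is_diff_sumf R V R _ (index_enum 'I_d) _ _ x
    (fun l => is_diff_mulf (@is_diff_csts R V R (k * O l j) x)
      (@is_diff_addf R V R _ _ _ _ _
        (is_diff_mulf (@is_diff_csts R V R ((i == l)%:R) x) hq)
        (is_diff_mulf (@is_diff_csts R V R (- 2) x)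
          (is_diff_mulf (is_diff_mulf hq hq) (is_diff_mulf (hz i) (hz l)))))).
set F := (X in is_diff _ X _ -> _); set dF := (X in is_diff _ _ X -> _).
rewrite (_ : F = fun y => invmap_jac k p O y i j); last first.
  apply/funext => y; rewrite /F !mxE mulr_sumr; apply: eq_bigr => l _.
  by rewrite !mxE big_ord1 !mxE -/(qinv p y); ring.
rewrite (_ : dF = fun v => invmap_jac2 k p O x v i j)//.
by apply/funext => v; rewrite /dF !mxE; apply: eq_bigr => l _; ring.
Qed.

Lemma opnorm_scale_orth (c : R) (Q : 'M[R]_d) : (0 < d)%N -> 0 <= c ->
  Q *m Q^T = 1%:M -> opnorm (c *: Q) = c.
Proof.
move=> d0 c0 hQ.
have E v : enorm (v *m (c *: Q)) = c * enorm v.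
  by rewrite -scalemxAr enormZ enorm_mulmx// ger0_norm.
pose e : V := delta_mx ord0 (Ordinal d0).
have e1 : enorm e = 1.
  rewrite enormE /dot (bigD1 (Ordinal d0))//= big1 ?addr0.
    by rewrite !mxE !eqxx mulr1 sqrtr1.
  by move=> i /negbTE h; rewrite !mxE h andbF mulr0.
apply/eqP; rewrite eq_le; apply/andP; split.
  apply: ge_sup; first by exists (enorm (e *m (c *: Q))), e => //=; rewrite e1.
  by move=> _ [v /= v1 <-]; rewrite E ler_piMr.
apply: ub_le_sup; last by exists e; rewrite /= ?E ?e1 ?mulr1.
by exists c => _ [v /= v1 <-]; rewrite E ler_piMr.
Qed.

Lemma opnorm_jacobian_invmap b k p O x : (0 < d)%N -> 0 < k -> O *m O^T = 1%:M ->
  x != p -> opnorm ('J (finite_part (invmap b k p O)) x) = k * qinv p x.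
Proof.
move=> d0 k0 hO xp; rewrite jacobian_invmap// opnorm_scale_orth//.
  by rewrite mulr_ge0 ?(ltW k0)// invr_ge0 dot_ge0.
by apply: mulmx_orth => //; apply: reflection_orth; rewrite subr_eq0.
Qed.

Lemma is_diff_ln (t : R) : 0 < t -> is_diff t (@ln R) (fun h => h / t).
Proof.
move=> t0; have [h1 h2] := is_derive1_ln t0.
have dl : differentiable (@ln R) t by exact/derivable1_diffP.
by apply: DiffDef => //; rewrite diff1E// derive1E h2; apply/funext.
Qed.

Lemma grad_log_invmap b k p O x : (0 < d)%N -> 0 < k -> O *m O^T = 1%:M ->
  x != p -> grad_log_D (finite_part (invmap b k p O)) x = -2 *: sphinv (x - p).
Proof.
move=> d0 k0 hO xp; apply/rowP => i; rewrite !mxE.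
have q0 : 0 < k * qinv p x by rewrite mulr_gt0// invr_gt0 dot_gt0// subr_eq0.
have hl := @is_diff_comp R V R R _ _ _ _ x
  (is_diff_mulf (@is_diff_csts R V R k x) (is_diff_qinv xp)) (is_diff_ln q0).
have h : is_diff x (fun y => ln (opnorm ('J (finite_part (invmap b k p O)) y)))
    (fun v => (k * dqinv p x v + qinv p x * 0) / (k * qinv p x)).
  apply: near_eq_is_diff hl.
  by apply: filterS (near_neq xp) => y yp; rewrite opnorm_jacobian_invmap.
rewrite deriveE; last exact: ex_diff.
rewrite (diff_val (is_diff_def := h)) /dqinv.
have -> : dot (x - p) (delta_mx ord0 i) = (x - p) ord0 i.
  rewrite /dot (bigD1 i)//= big1 ?addr0 => [|j /negbTE ji]; rewrite !mxE ?ji ?andbF ?mulr0//.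
  by rewrite !eqxx mulr1.
have q1 : qinv p x != 0 by rewrite invr_neq0// dot_eq0 subr_eq0.
rewrite !mxE -/(qinv p x); field.
by rewrite q1 gt_eqF.
Qed.

End InvmapDifferential.

(** * C2 dependence on a translation of the pole *)

Section BoundedLipschitz.
Variables (R : realType) (d : nat) (T : Type).
Local Notation V := 'rV[R]_d.
Variables (A : set V) (P : set T).
Implicit Types F G : T -> V -> R.

(** Boundedness is carried along because products preserve the Lipschitz property only for bounded
    factors. The parameter [t] becomes the direction [u] of the second derivative, over which the
    constant must be uniform. *)
Definition bounded_lipschitz F := exists2 C : R, 0 <= C &
  forall t z, P t -> A z -> `|F t z| <= C /\
    forall w, A w -> `|F t z - F t w| <= C * enorm (z - w).

Lemma bl_cst (c : T -> R) (C : R) : (forall t, P t -> `|c t| <= C) ->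
  bounded_lipschitz (fun t _ => c t).
Proof.
move=> hc; exists (Num.max 0 C) => [|t z Pt _]; first by rewrite le_max lexx.
split=> [|w _]; first by rewrite le_max hc ?orbT.
by rewrite subrr normr0 mulr_ge0 ?enorm_ge0// le_max lexx.
Qed.

Lemma bl_cst0 (c : R) : bounded_lipschitz (fun _ _ => c).
Proof. exact: (@bl_cst (fun=> c) `|c|). Qed.

Lemma bl_add F G : bounded_lipschitz F -> bounded_lipschitz G ->
  bounded_lipschitz (fun t z => F t z + G t z).
Proof.
move=> [C C0 hF] [D D0 hG]; exists (C + D) => [|t z Pt Az]; first exact: addr_ge0.
have [F1 F2] := hF t z Pt Az; have [G1 G2] := hG t z Pt Az; split=> [|w Aw].
  by rewrite (le_trans (ler_normD _ _))// lerD.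
by rewrite opprD addrACA mulrDl (le_trans (ler_normD _ _))// lerD ?F2 ?G2.
Qed.

Lemma bl_mul F G : bounded_lipschitz F -> bounded_lipschitz G ->
  bounded_lipschitz (fun t z => F t z * G t z).
Proof.
move=> [C C0 hF] [D D0 hG]; exists (2 * C * D) => [|t z Pt Az].
  by rewrite !mulr_ge0.
have [F1 F2] := hF t z Pt Az; have [G1 G2] := hG t z Pt Az.
have CD : `|F t z * G t z| <= C * D by rewrite normrM ler_pM.
have CD0 : 0 <= C * D by rewrite mulr_ge0.
split=> [|w Aw]; first by nra.
have [F3 _] := hF t w Pt Aw.
have -> : F t z * G t z - F t w * G t w =
  (F t z - F t w) * G t z + F t w * (G t z - G t w) by ring.
rewrite (le_trans (ler_normD _ _))// !normrM.
have H1 : `|F t z - F t w| * `|G t z| <= C * enorm (z - w) * D.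
  by rewrite ler_pM// F2.
have H2 : `|F t w| * `|G t z - G t w| <= C * (D * enorm (z - w)).
  by rewrite ler_pM// G2.
by nra.
Qed.

Lemma bl_sum (I : Type) (r : seq I) (F : I -> T -> V -> R) :
  (forall i, bounded_lipschitz (F i)) ->
  bounded_lipschitz (fun t z => \sum_(i <- r) F i t z).
Proof.
move=> hF; elim: r => [|i r IH].
  have := bl_cst0 0; congr bounded_lipschitz.
  by apply/funext => t; apply/funext => z; rewrite big_nil.
have := bl_add (hF i) IH; congr bounded_lipschitz.
by apply/funext => t; apply/funext => z; rewrite big_cons.
Qed.

Lemma bl_coord (L : R) i : (forall z, A z -> enorm z <= L) ->
  bounded_lipschitz (fun _ z => z ord0 i).
Proof.
move=> AL; exists (`|L| + 1) => [|_ z _ Az]; first by rewrite addr_ge0.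
split=> [|w _].
  by have := coord_le_enorm z i; have := AL _ Az; have := ler_norm L; lra.
have := coord_le_enorm (z - w) i; rewrite !mxE => /le_trans; apply.
by rewrite ler_peMl ?enorm_ge0// lerDr.
Qed.

Lemma bl_inv F (c : R) : 0 < c -> (forall t z, P t -> A z -> c <= F t z) ->
  bounded_lipschitz F -> bounded_lipschitz (fun t z => (F t z)^-1).
Proof.
move=> c0 cF [C C0 hF]; exists (c^-1 + c^-1 * C * c^-1) => [|t z Pt Az].
  by rewrite addr_ge0 ?mulr_ge0 ?invr_ge0 ?(ltW c0).
have Fz := cF t z Pt Az; have Fz0 : 0 < F t z by exact: lt_le_trans Fz.
have iF : `|(F t z)^-1| <= c^-1.
  by rewrite gtr0_norm ?invr_gt0// lef_pV2.
split=> [|w Aw].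
  by rewrite (le_trans iF)// lerDl !mulr_ge0 ?invr_ge0 ?(ltW c0).
have Fw := cF t w Pt Aw; have Fw0 : 0 < F t w by exact: lt_le_trans Fw.
have iFw : `|(F t w)^-1| <= c^-1.
  by rewrite gtr0_norm ?invr_gt0// lef_pV2.
have -> : (F t z)^-1 - (F t w)^-1 = (F t z)^-1 * (F t w - F t z) * (F t w)^-1.
  by field; rewrite !gt_eqF.
rewrite mulrDl !normrM (distrC (F t w)).
apply: ler_wpDl; first by rewrite mulr_ge0 ?invr_ge0 ?enorm_ge0// ltW.
have [_ /(_ w Aw) h] := hF t z Pt Az.
rewrite -mulrA (_ : c^-1 * C * c^-1 * _ = c^-1 * ((C * enorm (z - w)) * c^-1)); last ring.
by do 2?apply: ler_pM => //; rewrite ?mulr_ge0.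
Qed.

End BoundedLipschitz.

Section C2Perturbation.
Variables (R : realType) (d : nat).
Local Notation V := 'rV[R]_d.
Implicit Types (b p s x y u v z w : V) (k : R) (O M : 'M[R]_d).

Lemma enorm_mulmx_le M v : enorm v <= 1 ->
  enorm (v *m M) <= \sum_j \sum_i `|M i j|.
Proof.
move=> v1; apply: le_trans (enorm_le_sum _) _; apply: ler_sum => j _; rewrite mxE.
apply: le_trans (ler_norm_sum _ _ _) _; apply: ler_sum => i _.
by rewrite normrM ler_piMl// (le_trans (coord_le_enorm _ _)).
Qed.

Lemma opnorm_le_sum M : opnorm M <= \sum_j \sum_i `|M i j|.
Proof.
apply: ge_sup => [|_ [v /= v1 <-]]; last exact: enorm_mulmx_le.
by exists (enorm (0 *m M)), 0 => //=; rewrite enorm0.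
Qed.

Lemma opnorm2_le_sum (B : V -> 'M[R]_d) (C : R) :
  (forall u, enorm u <= 1 -> forall i j, `|B u i j| <= C) ->
  opnorm2 B <= \sum_(j < d) \sum_(i < d) C.
Proof.
move=> hB; apply: ge_sup => [|_ [[u v] /= [u1 v1] <-]].
  by exists (enorm (0 *m B 0)), (0, 0) => //=; rewrite enorm0.
apply: le_trans (enorm_mulmx_le _ v1) _.
by apply: ler_sum => j _; apply: ler_sum => i _; exact: hB.
Qed.

Definition annulus (a L : R) : set V := [set z | a <= enorm z /\ enorm z <= L].

Lemma bl_qinv (a L : R) : 0 < a ->
  bounded_lipschitz (annulus a L) [set u : V | enorm u <= 1]
    (fun _ z => (dot z z)^-1).
Proof.
move=> a0; have cL z : annulus a L z -> enorm z <= L by case.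
apply: (@bl_inv _ _ _ _ _ _ (a ^+ 2)); first by rewrite exprn_gt0.
  by move=> _ z _ [az _]; rewrite -enorm_sqr lerXn2r// nnegrE ?enorm_ge0// ltW.
by apply: bl_sum => i; apply: bl_mul; exact: bl_coord cL.
Qed.

Lemma bl_param (i : 'I_d) (A : set V) :
  bounded_lipschitz A [set u : V | enorm u <= 1] (fun u _ => u ord0 i).
Proof.
by apply: (@bl_cst _ _ _ _ _ _ 1) => u /= u1; rewrite (le_trans (coord_le_enorm _ _)).
Qed.

Lemma bl_jac (a L k : R) O i j : 0 < a ->
  bounded_lipschitz (annulus a L) [set u : V | enorm u <= 1]
    (fun _ z => invmap_jac k 0 O z i j).
Proof.
move=> a0; have cL z : annulus a L z -> enorm z <= L by case.
rewrite (_ : (fun (_ : V) z => invmap_jac k 0 O z i j) = fun _ z => \sum_l (k * O l j) *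
    ((dot z z)^-1 * ((i == l)%:R + (-2) * ((dot z z)^-1 * (z ord0 i * z ord0 l))))).
  apply: bl_sum => l; apply: bl_mul; first exact: bl_cst0.
  apply: bl_mul; first exact: bl_qinv.
  apply: bl_add; first exact: bl_cst0.
  apply: bl_mul; first exact: bl_cst0.
  by apply: bl_mul; [exact: bl_qinv|apply: bl_mul; exact: bl_coord cL].
apply/funext => t; apply/funext => z; rewrite !mxE mulr_sumr.
by apply: eq_bigr => l _; rewrite !mxE big_ord1 !mxE /qinv !subr0; ring.
Qed.

Lemma bl_jac2 (a L k : R) O i j : 0 < a ->
  bounded_lipschitz (annulus a L) [set u : V | enorm u <= 1]
    (fun u z => invmap_jac2 k 0 O z u i j).
Proof.
move=> a0; have cL z : annulus a L z -> enorm z <= L by case.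
pose q (u z : V) := (dot z z)^-1.
pose dq (u z : V) := (-2) * (q u z * (q u z * \sum_m z ord0 m * u ord0 m)).
rewrite (_ : (fun u z => invmap_jac2 k 0 O z u i j) = fun u z => \sum_l (k * O l j) *
    ((i == l)%:R * dq u z + (-2) * (2 * (q u z * dq u z) *
      (z ord0 i * z ord0 l) + q u z * (q u z *
      (z ord0 i * u ord0 l + z ord0 l * u ord0 i))))).
  have hq : bounded_lipschitz (annulus a L) [set u : V | enorm u <= 1] q.
    exact: bl_qinv.
  have hz m := bl_coord [set u : V | enorm u <= 1] m cL.
  have hu m := bl_param m (annulus a L).
  have hdq : bounded_lipschitz (annulus a L) [set u : V | enorm u <= 1] dq.
    apply: bl_mul; first exact: bl_cst0.
    do 2!apply: bl_mul => //.
    by apply: bl_sum => m; apply: bl_mul.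
  apply: bl_sum => l; apply: bl_mul; first exact: bl_cst0.
  apply: bl_add; first by apply: bl_mul => //; exact: bl_cst0.
  apply: bl_mul; first exact: bl_cst0.
  apply: bl_add.
    apply: bl_mul; last by apply: bl_mul.
    by apply: bl_mul; [exact: bl_cst0|exact: bl_mul].
  by do 2!apply: bl_mul => //; apply: bl_add; exact: bl_mul.
apply/funext => u; apply/funext => z; rewrite !mxE.
apply: eq_bigr => l _; rewrite /dqinv /qinv !subr0 /dq /q -/(dot z u).
by congr (_ * _); ring.
Qed.

Lemma bl_matrix_bound (A P : set V) (F : V -> V -> 'M[R]_d) :
  (forall i j, bounded_lipschitz A P (fun u z => F u z i j)) ->
  exists2 C, 0 <= C & forall u z w, P u -> A z -> A w ->
    forall i j, `|(F u z - F u w) i j| <= C * enorm (z - w).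
Proof.
move=> h.
have h' i j : exists C : R, 0 <= C /\ forall u z w, P u -> A z -> A w ->
    `|(F u z - F u w) i j| <= C * enorm (z - w).
  have [C C0 hC] := h i j; exists C; split=> // u z w Pu Az Aw.
  by rewrite !mxE; exact: (hC u z Pu Az).2.
pose C i j := sval (cid (h' i j)).
have C0 i j : 0 <= C i j by rewrite /C; case: cid => c [].
have hC i j := (svalP (cid (h' i j))).2.
exists (\sum_i \sum_j C i j) => [|u z w Pu Az Aw i j].
  by apply: sumr_ge0 => i _; apply: sumr_ge0.
apply: le_trans (hC i j u z w Pu Az Aw) _; rewrite -/(C i j).
apply: ler_wpM2r; first exact: enorm_ge0.
rewrite (bigD1 i)//= (bigD1 j)//= -addrA lerDl addr_ge0// ?sumr_ge0// => i' _.
by rewrite sumr_ge0.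
Qed.

Lemma invmap_jac0 k p O x : invmap_jac k p O x = invmap_jac k 0 O (x - p).
Proof. by rewrite /invmap_jac /qinv !subr0. Qed.

Lemma invmap_jac20 k p O x u : invmap_jac2 k p O x u = invmap_jac2 k 0 O (x - p) u.
Proof. by rewrite /invmap_jac2 /dqinv /qinv !subr0. Qed.

(** Moving the pole by [s] amounts to evaluating the formulas with pole 0 at a point displaced by
    [- s]. Lipschitz bounds on an annulus around 0 thus control all three terms of the distance. *)
Lemma C2_dist_shift (Omega : set V) b k p O (a L : R) :
  0 < k -> O *m O^T = 1%:M -> 0 < a ->
  (forall x, closure Omega x -> a <= enorm (x - p) /\ enorm (x - p) <= L) ->
  exists2 C, 0 <= C & forall s, enorm s <= a / 2 ->
    (C2_dist Omega (finite_part (invmap b k p O))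
       (finite_part (invmap b k (p + s)%R O)) <= (C * enorm s)%:E)%E.
Proof.
move=> k0 hO a0 hp; have a20 : 0 < a / 2 by rewrite divr_gt0.
(* The annulus is widened so that it contains both [x - p] and [x - (p + s)] when
   [enorm s <= a / 2]. *)
pose A := annulus (a / 2) (L + a).
have [C1 C10 h1] := bl_matrix_bound (fun i j => bl_jac (L + a) k O i j a20).
have [C2 C20 h2] := bl_matrix_bound (fun i j => bl_jac2 (L + a) k O i j a20).
pose C0 := k / (a / 2) ^+ 2.
pose D (C : R) := \sum_(j < d) \sum_(i < d) C.
have D0 C : 0 <= C -> 0 <= D C.
  by move=> c0; apply: sumr_ge0 => ? _; apply: sumr_ge0.
exists (C0 + D C1 + D C2) => [|s sa].
  by rewrite !addr_ge0 ?D0// divr_ge0 ?sqr_ge0// ltW.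
have Ax x : closure Omega x -> A (x - p).
  by move=> /hp [h h']; split; lra.
have Axs x : closure Omega x -> A (x - (p + s)).
  move=> /hp [h h']; rewrite /A /annulus /= opprD addrA.
  have := ler_enormB (x - p) s; have := ler_enormD (x - p - s) s.
  by rewrite subrK => ? ?; split; lra.
have E x : x - p - (x - (p + s)) = s by rewrite opprB !addrA subrK addrAC subrr add0r.
have xp x q : A (x - q) -> x != q.
  by move=> [h _]; rewrite -subr_eq0 -enorm_gt0 (lt_le_trans a20).
have b0 : enorm (0 : V) <= 1 by rewrite enorm0.
rewrite 2!mulrDl !EFinD; apply: leeD; first apply: leeD.
- apply: ge_ereal_sup => _ [x /= Ox <-]; rewrite lee_fin.
  have [z1 z2] := (xp _ _ (Ax _ Ox), xp _ _ (Axs _ Ox)).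
  rewrite !finite_part_invmap// opprD addrACA subrr add0r.
  rewrite -scalerBr -mulmxBl enormZ enorm_mulmx// gtr0_norm//.
  rewrite enorm_sphinvB ?subr_eq0// E /C0 mulrAC mulrA; apply: ler_wpM2l.
    by rewrite mulr_ge0 ?enorm_ge0// ltW.
  rewrite lef_pV2 ?posrE ?exprn_gt0 ?mulr_gt0 ?enorm_gt0 ?subr_eq0//.
  by rewrite expr2 ler_pM ?(ltW a20)//; [case: (Ax _ Ox)|case: (Axs _ Ox)].
- apply: ge_ereal_sup => _ [x /= Ox <-]; rewrite lee_fin.
  have [z1 z2] := (xp _ _ (Ax _ Ox), xp _ _ (Axs _ Ox)).
  rewrite !jacobian_invmap// invmap_jac0 [X in _ - X]invmap_jac0.
  apply: le_trans (opnorm_le_sum _) _; rewrite mulr_suml; apply: ler_sum => j _.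
  rewrite mulr_suml; apply: ler_sum => i _.
  by have := h1 0 _ _ b0 (Ax _ Ox) (Axs _ Ox) i j; rewrite E.
- apply: ge_ereal_sup => _ [x /= Ox <-]; rewrite lee_fin.
  have [z1 z2] := (xp _ _ (Ax _ Ox), xp _ _ (Axs _ Ox)).
  have -> : D C2 * enorm s = D (C2 * enorm s).
    by rewrite /D mulr_suml; apply: eq_bigr => ? _; rewrite mulr_suml.
  apply: opnorm2_le_sum => u u1 i j; rewrite !D2_invmap//.
  rewrite invmap_jac20 [X in _ - X]invmap_jac20.
  by have := h2 u _ _ u1 (Ax _ Ox) (Axs _ Ox) i j; rewrite E.
Qed.

End C2Perturbation.

(** * Poles of words in perturbed generators *)

Section MixedWords.
Variables (R : realType) (d : nat) (Omega : set 'rV[R]_d) (Idx Shf : Type).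
Local Notation V := 'rV[R]_d.
Local Notation Vh := (extended_space R d).
Variables (b p : Idx -> V) (k : Idx -> R) (Oi : Idx -> 'M[R]_d) (sh : Shf -> V).
Variables (lam rho D : R).
Implicit Types (l : Idx * Shf) (u v w : seq (Idx * Shf)).

(* Every letter carries its own translation, so that the words of two perturbed
   systems can be interpolated by mixed words. *)
Definition letter_map l : Vh -> Vh := invmap (b l.1) (k l.1) (p l.1 + sh l.2) (Oi l.1).
Definition letter_inv l : Vh -> Vh := invmap (p l.1 + sh l.2) (k l.1) (b l.1) (Oi l.1)^T.

Definition word_fun w : Vh -> Vh := foldl (fun h l => letter_map l \o h) id w.
Definition word_inv w : Vh -> Vh := foldr (fun l h => letter_inv l \o h) id w.
Definition word_pole w : V := if word_inv w None is Some y then y else 0.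

Lemma word_fun_foldl (h : Vh -> Vh) w : foldl (fun h l => letter_map l \o h) h w = word_fun w \o h.
Proof.
rewrite /word_fun; elim: w h => [//|l w IH] h /=.
by rewrite IH [in RHS]IH.
Qed.

Lemma word_fun_cons l w : word_fun (l :: w) = word_fun w \o letter_map l.
Proof. by rewrite /word_fun /= word_fun_foldl. Qed.

Lemma word_inv_cat u v : word_inv (u ++ v) = word_inv u \o word_inv v.
Proof. by elim: u => [//|l u /= ->]. Qed.

(** The estimates on generators that survive small translations, uniformly in the translation.
    [ms_contract] is the derivative bound k/|x-p|^2 <= lam with the denominator cleared. *)
Record mixed_system : Prop := {
  ms_lam_gt0 : 0 < lam;
  ms_lam_lt1 : lam < 1;
  ms_gap_gt0 : 0 < D;
  ms_radius_gt0 : forall i, 0 < k i;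
  ms_orth : forall i, Oi i *m (Oi i)^T = 1%:M;
  ms_centre_in : forall i, Omega (b i);
  ms_map_in : forall l x, closure Omega x -> Omega (finite_part (letter_map l) x);
  ms_contract : forall l x, closure Omega x ->
    k l.1 <= lam * enorm (x - (p l.1 + sh l.2)) ^+ 2;
  ms_pole_gap : forall l x, closure Omega x -> D <= enorm (x - (p l.1 + sh l.2));
  ms_centre_gap : forall i y, ~ Omega y -> rho <= enorm (y - b i);
  ms_image_gap : forall l x y, closure Omega x -> ~ Omega y ->
    rho <= enorm (y - finite_part (letter_map l) x)
}.

Hypothesis sys : mixed_system.
Let lam0 := ms_lam_gt0 sys.
Let lam1 := ms_lam_lt1 sys.
Let D0 := ms_gap_gt0 sys.
Let k0 := ms_radius_gt0 sys.
Let hO := ms_orth sys.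
Let hb := ms_centre_in sys.
Let hmap := ms_map_in sys.
Let hlam := ms_contract sys.
Let hD := ms_pole_gap sys.
Let hrhob := ms_centre_gap sys.
Let hrho := ms_image_gap sys.

(** An invariant strong enough for prepending a letter: the new radius is divided by the squared
    distance from the centre of that letter to the old pole, so radius and pole distance must be
    controlled together. The bound on [kw] says |Df_w| <= lam^n on the closure. *)
Definition word_data w (bw : V) (kw : R) (Ow : 'M[R]_d) : Prop :=
  [/\ 0 < kw, Ow *m Ow^T = 1%:M, word_fun w = invmap bw kw (word_pole w) Ow &
      word_inv w = invmap (word_pole w) kw bw Ow^T] /\
  [/\ Omega bw, forall y, ~ Omega y -> rho <= enorm (y - bw) &
    forall x, closure Omega x ->
    [/\ Omega (finite_part (word_fun w) x),
        forall y, ~ Omega y -> rho <= enorm (y - finite_part (word_fun w) x),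
        kw <= lam ^+ size w * enorm (x - word_pole w) ^+ 2 &
        D * (1 - lam) <= enorm (x - word_pole w)]].

Lemma word_invK w : cancel (word_inv w) (word_fun w).
Proof.
elim: w => [//|l w IH] x; rewrite word_fun_cons /=.
rewrite [letter_map l _](invmapVK _ _ (k0 l.1) (hO l.1)); exact: IH.
Qed.

Lemma pole_dist_gt0 : 0 < D * (1 - lam).
Proof. by rewrite mulr_gt0// subr_gt0. Qed.

Lemma enorm_sub_gt0 (x y : V) (c : R) : 0 < c -> c <= enorm (x - y) -> x != y.
Proof. by move=> c0 h; rewrite -subr_eq0 -enorm_gt0 (lt_le_trans c0). Qed.

Lemma letter_neq l x : closure Omega x -> x != p l.1 + sh l.2.
Proof. by move=> /(hD l); exact: enorm_sub_gt0. Qed.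

Lemma letter_fin l x : closure Omega x ->
  letter_map l (Some x) = Some (finite_part (letter_map l) x).
Proof. by move=> /(letter_neq l) xp; rewrite /finite_part /letter_map invmap_fin. Qed.

Lemma letter_dist l x y : x != p l.1 + sh l.2 -> y != p l.1 + sh l.2 ->
  enorm (finite_part (letter_map l) x - finite_part (letter_map l) y) =
  k l.1 * enorm (x - y) / (enorm (x - (p l.1 + sh l.2)) * enorm (y - (p l.1 + sh l.2))).
Proof.
move=> xp yp; rewrite !finite_part_invmap// [_ + k l.1 *: _]addrC addrKA.
exact: enorm_invmapB.
Qed.

Lemma letter_dist_infty l x : x != p l.1 + sh l.2 ->
  enorm (b l.1 - finite_part (letter_map l) x) = k l.1 / enorm (x - (p l.1 + sh l.2)).
Proof.
move=> xp; rewrite finite_part_invmap// enormB [_ + k l.1 *: _]addrC addrK enormZ.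
by rewrite enorm_mulmx// gtr0_norm// enorm_sphinv.
Qed.

(** The new map is [word_fun w'] after [letter_map l], so the hypothesis for [w'] is evaluated at
    the image of [x] and at [b l.1], both of which lie in [Omega]. *)
Lemma word_dataP l w : exists bw kw Ow, word_data (l :: w) bw kw Ow.
Proof.
elim: w l => [|l' w IH] l.
  have E : word_pole [:: l] = p l.1 + sh l.2 by [].
  have FE : word_fun [:: l] = letter_map l by [].
  exists (b l.1), (k l.1), (Oi l.1); split; first by split.
  split=> [//|y|x Ox]; first exact: hrhob.
  rewrite FE expr1 E; split; [exact: hmap|by move=> y; exact: hrho|exact: hlam|].
  by apply: le_trans (hD l Ox); rewrite ler_piMr ?(ltW D0)// gerBl ltW.
have [b' [k' [ O' [[k'0 hO' FE GE] [Ob' _ H']]]]] := IH l'.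
set w' := l' :: w in FE GE H' *.
have Ocl x : Omega x -> closure Omega x by exact: subset_closure.
have bp : b l.1 != word_pole w'.
  by have [_ _ _] := H' _ (Ocl _ (hb l.1)); apply: enorm_sub_gt0; exact: pole_dist_gt0.
have [bw [pw [Ow [hOw E]]]] := invmap_comp (p l.1 + sh l.2) b' (k0 l.1) k'0 (hO l.1) hO' bp.
set kw := k l.1 * k' / _ in E.
have FE' : word_fun (l :: w') = invmap bw kw pw Ow.
  by rewrite word_fun_cons FE; exact: E.
have a0 : 0 < enorm (b l.1 - word_pole w') by rewrite enorm_gt0 subr_eq0.
have kw0 : 0 < kw by rewrite /kw divr_gt0 ?(mulr_gt0 (k0 l.1) k'0)// exprn_gt0.
have GE' : word_inv (l :: w') = invmap pw kw bw Ow^T.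
  apply/funext => q; apply: (can_inj (invmapK bw pw kw0 hOw)).
  by rewrite invmapVK// -FE' word_invK.
have pE : word_pole (l :: w') = pw by rewrite /word_pole GE'.
have Fx x : closure Omega x ->
    finite_part (word_fun (l :: w')) x = finite_part (word_fun w') (finite_part (letter_map l) x).
  by move=> Ox; rewrite word_fun_cons [LHS]/finite_part /comp letter_fin.
have Hl x : closure Omega x -> closure Omega (finite_part (letter_map l) x).
  by move=> /(hmap l)/Ocl.
have bE : bw = finite_part (word_fun w') (b l.1).
  have : word_fun (l :: w') None = Some bw by rewrite FE'.
  by rewrite word_fun_cons /= /finite_part => ->.
exists bw, kw, Ow; rewrite /word_data pE; split; first by split.
have [Ob _ rb] : [/\ Omega bw, True & forall y, ~ Omega y -> rho <= enorm (y - bw)].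
  by rewrite bE; have [? ? _ _] := H' _ (Ocl _ (hb l.1)).
split=> // x Ox.
have [H1 H2 H3 H4] := H' _ (Hl _ Ox).
rewrite Fx//.
(* The first letter carries the pole of the whole word to the pole of the rest, so [letter_dist]
   relates the distances to the two poles. *)
have FP : letter_map l (Some pw) = Some (word_pole w').
  have : word_fun (l :: w') (Some pw) = None by rewrite FE' invmap_pole.
  rewrite word_fun_cons FE /comp; case: (letter_map l (Some pw)) => [y|//].
  by rewrite /invmap; case: eqVneq => [->|].
have pp : pw != p l.1 + sh l.2.
  by apply/eqP => h; move: FP; rewrite h /letter_map invmap_pole.
have fP : finite_part (letter_map l) pw = word_pole w' by rewrite /finite_part FP.
have xl := letter_neq l Ox.
have dx := letter_dist xl pp; have db := letter_dist_infty pp; rewrite fP in dx db.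
have B0 : 0 < enorm (x - (p l.1 + sh l.2)) by rewrite enorm_gt0 subr_eq0.
have C0 : 0 < enorm (pw - (p l.1 + sh l.2)) by rewrite enorm_gt0 subr_eq0.
have kl := hlam l Ox; have Dl := hD l Ox.
have tri := ler_enorm_dist pw x (p l.1 + sh l.2).
have A0 := enorm_ge0 (x - pw).
move: A0 dx db B0 C0 kl Dl tri H3 H4; set A := enorm (x - pw).
set B := enorm (x - _); set C := enorm (pw - _); set X := enorm (_ - word_pole w').
move: A B C X => A B C X A0 dx db B0 C0 kl Dl tri H3 H4; split=> //.
- have Xe : X = enorm (b l.1 - word_pole w') * A / B.
    by rewrite dx db; field; rewrite !gt_eqF.
  rewrite /kw ler_pdivrMr ?exprn_gt0//.
  apply: le_trans (_ : lam * B ^+ 2 * (lam ^+ size w' * X ^+ 2) <= _).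
    by rewrite ler_pM// ltW.
  rewrite Xe le_eqVlt; apply/orP; left; apply/eqP.
  rewrite [size (l :: w')]/= (exprS lam); move: (lam ^+ _) => t.
  by field; rewrite gt_eqF.
(* In reciprocals the argument reads 1/A <= lam/(D(1-lam)) + 1/B <= lam/(D(1-lam)) + 1/D =
   1/(D(1-lam)). Thus D(1-lam) is the fixed point of the recursion, which is the geometric series
   bounding |T_w| = 2/A. *)
- have h1 : D * (1 - lam) * (B * C) <= k l.1 * A.
    by rewrite -ler_pdivlMr ?mulr_gt0// -dx.
  have h2 : D * (1 - lam) * C <= lam * B * A.
    rewrite -(ler_pM2r B0); have := ler_wpM2r A0 kl; nra.
  have h3 : D * (1 - lam) * B <= A * (lam * B + D * (1 - lam)).
    have := pole_dist_gt0; nra.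
  have h4 : D * (1 - lam) <= (1 - lam) * B.
    by rewrite mulrC ler_wpM2l// subr_ge0 ltW.
  have h5 : A * (lam * B + D * (1 - lam)) <= A * B.
    by rewrite ler_wpM2l//; lra.
  by rewrite -(ler_pM2r B0); lra.
Qed.

Lemma word_dataN0 w : w <> [::] -> exists bw kw Ow, word_data w bw kw Ow.
Proof. by case: w => // l w _; exact: word_dataP. Qed.

Lemma word_dataT w : w <> [::] -> {D : V * R * 'M[R]_d | word_data w D.1.1 D.1.2 D.2}.
Proof.
move=> /word_dataN0 h; apply: cid; have [bw [kw [Ow hw]]] := h.
by exists (bw, kw, Ow).
Qed.

Lemma word_inv_None w : w <> [::] -> word_inv w None = Some (word_pole w).
Proof. by move=> /word_dataT[[[bw kw] Ow] [[_ _ _ GE] _]]; rewrite GE. Qed.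

Lemma word_pole_far w x : w <> [::] -> closure Omega x -> D * (1 - lam) <= enorm (x - word_pole w).
Proof. by move=> /word_dataT[[[bw kw] Ow] [_ [_ _ h]]] /h[]. Qed.

Lemma word_pole_notin w : w <> [::] -> ~ Omega (word_pole w).
Proof.
move=> w0 /subset_closure/(word_pole_far w0); rewrite subrr enorm0 leNgt.
by rewrite pole_dist_gt0.
Qed.

(** Two independent lower bounds for the distance from a pole to the centre of a word: centres are
    [rho]-deep in [Omega] while poles lie outside, and poles are [D * (1 - lam)] away from the
    closure. *)
Definition pole_gap : R := Num.max rho (D * (1 - lam)).

Lemma pole_gap_gt0 : 0 < pole_gap.
Proof. by rewrite lt_max pole_dist_gt0 orbT. Qed.

Lemma word_pole_gap u v bu ku Ou : word_data u bu ku Ou -> v <> [::] ->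
  pole_gap <= enorm (word_pole v - bu).
Proof.
move=> [_ [Obu hr _]] v0; rewrite ge_max; apply/andP; split.
  by apply: hr; exact: word_pole_notin.
by rewrite enormB; apply: word_pole_far => //; exact: subset_closure.
Qed.

(** One close point suffices, because the radius bound in [word_data] holds at every point of the
    closure. *)
Definition near_pole (R1 : R) w := exists2 x, closure Omega x & enorm (x - word_pole w) <= R1.

Lemma word_radius_le R1 u bu ku Ou : word_data u bu ku Ou -> near_pole R1 u ->
  ku <= lam ^+ size u * R1 ^+ 2.
Proof.
move=> [_ [_ _ h]] [x Ox xR]; have [_ _ h3 _] := h x Ox.
apply: le_trans h3 _; rewrite ler_wpM2l ?exprn_ge0 ?(ltW lam0)//.
by rewrite lerXn2r// nnegrE ?enorm_ge0// (le_trans (enorm_ge0 _) xR).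
Qed.

Lemma word_pole_catE u v bu ku Ou : word_data u bu ku Ou -> v <> [::] ->
  word_pole (u ++ v) = word_pole u + ku *: (sphinv (word_pole v - bu) *m Ou^T).
Proof.
move=> hu v0; have [[_ _ _ GE] _] := hu.
rewrite {1}/word_pole word_inv_cat /comp word_inv_None// GE invmap_fin//.
exact: enorm_sub_gt0 pole_gap_gt0 (word_pole_gap hu v0).
Qed.

(** The inverse of the map of [u] is an inversion about its centre with ratio at most lam^n R1^2,
    applied at points at least [pole_gap] from that centre. The factor [(R1 / pole_gap) ^+ 2] is the
    perturbed form of K. *)
Lemma word_pole_cat_contract R1 u v v' : u <> [::] -> v <> [::] -> v' <> [::] ->
  near_pole R1 u -> enorm (word_pole (u ++ v) - word_pole (u ++ v')) <=
    lam ^+ size u * (R1 / pole_gap) ^+ 2 * enorm (word_pole v - word_pole v').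
Proof.
move=> /word_dataT[[[bu ku] Ou]/= hu] v0 v'0 nu.
have [[ku0 hOu _ _] _] := hu; have m0 := pole_gap_gt0.
have [hv hv'] := (word_pole_gap hu v0, word_pole_gap hu v'0).
rewrite !(word_pole_catE hu)// [word_pole u + _]addrC addrKA enorm_invmapB ?mulmx_trC//;
  try exact: enorm_sub_gt0 m0 _.
have hk := word_radius_le hu nu.
rewrite mulrAC; apply: ler_wpM2r; first exact: enorm_ge0.
have ab0 := mulr_gt0 (lt_le_trans m0 hv) (lt_le_trans m0 hv').
rewrite expr_div_n mulrA; apply: ler_pM => //; rewrite ?invr_ge0 ?(ltW ku0) ?(ltW ab0)//.
by rewrite lef_pV2 ?posrE ?exprn_gt0// expr2 ler_pM// ltW.
Qed.

(** The pole of [u] itself is the value of the inverse map at infinity; compared with that value, a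
    finite argument costs the radius divided by its distance to the centre. *)
Lemma word_pole_cat_near R1 u v : u <> [::] -> v <> [::] -> near_pole R1 u ->
  enorm (word_pole (u ++ v) - word_pole u) <= lam ^+ size u * (R1 ^+ 2 / pole_gap).
Proof.
move=> /word_dataT[[[bu ku] Ou]/= hu] v0 nu.
have [[ku0 hOu _ _] _] := hu; have m0 := pole_gap_gt0; have hv := word_pole_gap hu v0.
rewrite (word_pole_catE hu)// addrC addKr enormZ enorm_mulmx ?mulmx_trC//.
rewrite enorm_sphinv gtr0_norm// mulrA ler_pM ?invr_ge0 ?enorm_ge0 ?(ltW ku0)//.
  exact: word_radius_le hu nu.
by rewrite lef_pV2 ?posrE// (lt_le_trans m0).
Qed.

Lemma word_pole_shift i s s' v : word_pole ((i, s) :: v) - word_pole ((i, s') :: v) = sh s - sh s'.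
Proof.
have sub0 (x : V) : x + sh s - (x + sh s') = sh s - sh s'.
  by rewrite [x + sh s]addrC addrKA.
case: v => [|l v]; first exact: sub0.
have E s0 : word_pole ((i, s0) :: l :: v) =
    p i + sh s0 + k i *: (sphinv (word_pole (l :: v) - b i) *m (Oi i)^T).
  rewrite [LHS]/word_pole -[(i, s0) :: _]cat1s word_inv_cat /comp word_inv_None//.
  rewrite -[word_inv _ _]/(invmap (p i + sh s0) (k i) (b i) (Oi i)^T (Some (word_pole (l :: v)))).
  rewrite invmap_fin//.
  by apply/eqP => h; apply: (@word_pole_notin (l :: v)) => //; rewrite h.
by rewrite !E [p i + sh s + _]addrAC [p i + sh s' + _]addrAC sub0.
Qed.

(** A list of triples (letter, s, s') encodes two words with the same letters and different
    translations. *)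
Definition left_word (t : seq (Idx * Shf * Shf)) := [seq (q.1.1, q.1.2) | q <- t].
Definition right_word (t : seq (Idx * Shf * Shf)) := [seq (q.1.1, q.2) | q <- t].

(** * Interpolation between words with different translations *)

Section Telescope.
Variables (R1 : R) (Q : pred (Idx * Shf)).
Hypothesis hQ : forall w, w <> [::] -> all Q w -> near_pole R1 w.

(** Translations are exchanged one letter at a time; the exchange behind a prefix of length m costs
    lam^m K e, and these costs sum geometrically. Every such prefix carries left translations, so
    nearness of poles is needed only for words satisfying [Q]. *)
Lemma word_pole_telescope (e : R) (u : seq (Idx * Shf)) (t : seq (Idx * Shf * Shf)) :
  u <> [::] -> t <> [::] -> all Q (u ++ left_word t) ->
  all (fun q => enorm (sh q.1.2 - sh q.2) <= e) t ->
  enorm (word_pole (u ++ left_word t) - word_pole (u ++ right_word t)) <=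
    lam ^+ size u * ((R1 / pole_gap) ^+ 2 * e / (1 - lam)).
Proof.
elim: t u => [//|[[i s] s'] t IH] u u0 _ Qu /= /andP[/= se te].
set A := (R1 / pole_gap) ^+ 2.
have l10 : 0 < 1 - lam by rewrite subr_gt0.
have A0 : 0 <= A by exact: sqr_ge0.
have e0 : 0 <= e by exact: le_trans (enorm_ge0 _) se.
have nu : near_pole R1 u by apply: hQ => //; move: Qu; rewrite all_cat => /andP[].
have swap : enorm (word_pole (u ++ (i, s) :: right_word t) -
      word_pole (u ++ (i, s') :: right_word t)) <=
    lam ^+ size u * (A * e).
  apply: le_trans (word_pole_cat_contract u0 _ _ nu) _ => //.
  by rewrite word_pole_shift -mulrA ler_wpM2l ?exprn_ge0 ?(ltW lam0)// ler_wpM2l.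
case: t IH Qu te swap => [|q t] IH Qu te swap.
  apply: le_trans swap _; rewrite ler_wpM2l ?exprn_ge0 ?(ltW lam0)//.
  rewrite ler_pdivlMr// (ler_piMr (mulr_ge0 A0 e0))//.
  by rewrite gerBl ltW.
have := IH (rcons u (i, s)); rewrite !cat_rcons size_rcons.
have rn : rcons u (i, s) <> [::] by case: (u).
have tn : q :: t <> [::] by [].
move=> /(_ rn tn Qu te) ih.
apply: le_trans (ler_enorm_dist (word_pole (u ++ (i, s) :: right_word (q :: t))) _ _) _.
apply: le_trans (lerD ih swap) _.
rewrite exprSr -mulrA -mulrDr ler_wpM2l ?exprn_ge0 ?(ltW lam0)// -/A.
by rewrite le_eqVlt; apply/orP; left; apply/eqP; field; rewrite gt_eqF.
Qed.

(** The inverse of the first letter acts last, so its change moves the pole by exactly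
    [sh s - sh s']. The other letters sit behind a prefix of length at least one, whence the factor
    [lam]. *)
Lemma word_pole_perturb (e : R) i s s' (t : seq (Idx * Shf * Shf)) :
  all Q (left_word ((i, s, s') :: t)) ->
  all (fun q => enorm (sh q.1.2 - sh q.2) <= e) ((i, s, s') :: t) ->
  enorm (word_pole (left_word ((i, s, s') :: t)) - word_pole (right_word ((i, s, s') :: t)) -
    (sh s - sh s')) <= lam * ((R1 / pole_gap) ^+ 2 * e / (1 - lam)).
Proof.
move=> Qt /= /andP[/= se te].
have e0 : 0 <= e by exact: le_trans (enorm_ge0 _) se.
rewrite -(word_pole_shift i s s' (right_word t)) opprB addrA subrK.
case: t Qt te => [|q t] Qt te.
  rewrite subrr enorm0 mulr_ge0 ?(ltW lam0)//.
  by rewrite divr_ge0 ?subr_ge0 ?(ltW lam1)// mulr_ge0// sqr_ge0.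
have un : [:: (i, s)] <> [::] by [].
have tn : q :: t <> [::] by [].
by have := word_pole_telescope un tn Qt te; rewrite expr1.
Qed.

End Telescope.

End MixedWords.

(** * Counting *)

Section Counting.
Variables (d N M : nat).
Local Notation grid := {ffun 'I_N.+1 -> {ffun 'I_d -> 'I_M.+1}}.

(* A set meeting every line in the direction e_a - e_b at most once is determined
   by the coordinates other than [b], once the [a]-coordinate is replaced by the
   sum of the [a]- and [b]-coordinates. *)
Lemma card_line_free (a b : 'I_N.+1) (bad : {set grid}) : a != b ->
  (forall t t', t \in bad -> t' \in bad ->
    (forall c, c != a -> c != b -> t c = t' c) ->
    (forall j, t a j + t b j = t' a j + t' b j)%N -> t = t') ->
  (#|bad| <= (M.+1.*2 ^ d) ^ N)%N.
Proof.
move=> ab line.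
pose f (t : grid) : {ffun 'I_N -> {ffun 'I_d -> 'I_(M.*2.+1).+1}} :=
  [ffun c => [ffun j => inord (if lift b c == a then t a j + t b j
                               else t (lift b c) j)%N]].
have lt1 (i : 'I_M.+1) : (i <= M)%N by rewrite -ltnS.
have small (t : grid) c j :
    ((if lift b c == a then t a j + t b j else t (lift b c) j) < M.*2.+2)%N.
  case: ifP => _; rewrite ltnS leqW// -addnn; first by rewrite leq_add.
  by rewrite (leq_trans (lt1 _)) ?leq_addr.
have inj : {in bad &, injective f}.
  move=> t t' ht ht' ff.
  have fE c j : (if lift b c == a then t a j + t b j else t (lift b c) j)%N =
      (if lift b c == a then t' a j + t' b j else t' (lift b c) j)%N.
    have := congr1 (fun g : {ffun 'I_N -> {ffun 'I_d -> 'I_(M.*2.+1).+1}} =>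
      val (g c j)) ff.
    rewrite /= !ffunE !inordK//.
  apply: line => // [c ca cb|j].
    have [c' cE] : exists c', c = lift b c'.
      by case: (unliftP b c) cb => [c' ->|->]; [exists c'|rewrite eqxx].
    apply/ffunP => j; apply: val_inj; have := fE c' j.
    by rewrite -cE (negbTE ca).
  have [c' cE] : exists c', a = lift b c'.
    by case: (unliftP b a) ab => [c' ->|->]; [exists c'|rewrite eqxx].
  by have := fE c' j; rewrite -cE eqxx.
rewrite -(card_in_imset inj); apply: leq_trans (max_card _) _.
by rewrite !card_ffun !card_ord doubleS.
Qed.

Lemma union_bound (T K : finType) (bad : K -> {set T}) (C : nat) :
  (forall x, #|bad x| <= C)%N -> (#|K| * C < #|T|)%N ->
  exists t, forall x, t \notin bad x.
Proof.
move=> hC hT; pose U := (\bigcup_x bad x)%SET.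
have /card_gt0P : (0 < #|~: U|)%N.
  rewrite -(ltn_add2l #|U|) addn0 cardsC.
  apply: leq_ltn_trans hT.
  apply: leq_trans (_ : \sum_(x : K) #|bad x| <= _)%N.
    rewrite /U; elim/big_rec2: _ => [|x n A _ IH]; first by rewrite cards0.
    by rewrite (leq_trans (leq_card_setU _ _))// leq_add2l.
  by rewrite -sum_nat_const leq_sum.
move=> [t]; rewrite inE => ht; exists t => x; apply: contra ht => tx.
by apply/finset.bigcupP; exists x.
Qed.

End Counting.

(** * Balancing the mesh of the grid against the number of pairs of words *)

Section GridSize.
Variable R : realType.

Lemma bernoulli (x : R) n : 0 <= x -> 1 + n%:R * x <= (1 + x) ^+ n.
Proof.
move=> x0; elim: n => [|n IH]; first by rewrite mul0r addr0 expr0.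
rewrite exprS -natr1; have n0 : 0 <= n%:R :> R by [].
have : 0 <= n%:R * x * x by rewrite !mulr_ge0.
by nra.
Qed.

(** With M of order lam^-n, the quotient of the two sides of the count is of order (n+1) q^n, where
    q = N^2 lam^d < 1. The factor n+1 accounts for all word lengths up to n, and 2^(dN) for the
    doubled range of a sum of two coordinates. *)
Lemma grid_size (d N : nat) (lam B : R) : (0 < d)%N ->
  0 < lam -> lam < 1 -> 0 < B -> N%:R ^+ 2 * lam ^+ d < 1 ->
  exists n M : nat, [/\ (0 < n)%N, M.+1%:R * lam ^+ n < B &
    ((n.+1 * (N ^ n * N ^ n)) * 2 ^ (d * N) < M.+1 ^ d)%N].
Proof.
move=> d0 l0 l1 B0; set q := _ * _ => q1.
have q0 : 0 <= q by rewrite mulr_ge0// ?exprn_ge0// ltW.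
(* Chosen so that (1 + x) q < 1 still holds: by Bernoulli's inequality the factor n+1 is absorbed
   into (1 + x)^n. *)
pose x := (1 - q) / 2.
have x0 : 0 < x by rewrite divr_gt0// subr_gt0.
pose y := (1 + x) * q.
have y1 : `|y| < 1.
  rewrite ger0_norm; last by rewrite /y mulr_ge0// addr_ge0// ltW.
  have h : 0 < (1 - q) * (2 - q) by apply: mulr_gt0; lra.
  rewrite (_ : y = 1 - (1 - q) * (2 - q) / 2); last by rewrite /y /x; field.
  lra.
have xB : x <= 1 by rewrite /x; lra.
pose eta := x * (B / 2) ^+ d / 2 ^+ (d * N).
have eta0 : 0 < eta.
  by rewrite divr_gt0 ?exprn_gt0// mulr_gt0// exprn_gt0// divr_gt0.
have /cvgr0_norm_lt hy := cvg_expr y1.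
have /cvg_expr/cvgr0_norm_lt hl : `|lam| < 1 by rewrite gtr0_norm.
have B4 : 0 < B / 4 by rewrite divr_gt0.
have /filter_ex[n [n0 yn]] : \forall n \near \oo,
    [/\ (0 < n)%N, `|y ^+ n| < eta & `|lam ^+ n| < B / 4].
  by apply: filterS3 (nbhs_infty_gt 0) (hy _ eta0) (hl _ B4) => n.
rewrite gtr0_norm ?exprn_gt0// => ln.
have ln0 : 0 < lam ^+ n by rewrite exprn_gt0.
(* As B/lam^n exceeds 4, the integer part of three quarters of it lies between one half of it and
   the whole. *)
pose z := B / lam ^+ n * (3 / 4).
have BY : 4 < B / lam ^+ n by rewrite ltr_pdivlMr//; lra.
have z0 : 0 <= z by rewrite /z; lra.
have /andP[t1 t2] := truncn_itv z0.
have : (0 < Num.truncn z)%N.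
  by rewrite lt0n; apply/eqP => h; move: t2; rewrite h /z => ?; lra.
case E: (Num.truncn z) t1 t2 => [//|M] t1 t2 _.
exists n, M; split=> //.
  by rewrite -ltr_pdivlMr// (le_lt_trans t1)// /z; lra.
have M2 : B / lam ^+ n / 2 <= M.+1%:R.
  by move: t2; rewrite -[M.+2%:R]natr1 /z; lra.
rewrite -(ltr_nat R) !natrM !natrX.
apply: lt_le_trans (_ : (B / lam ^+ n / 2) ^+ d <= _); last first.
  by rewrite lerXn2r// nnegrE; lra.
have -> : (B / lam ^+ n / 2) ^+ d = (B / 2) ^+ d / (lam ^+ d) ^+ n.
  by rewrite mulrAC exprMn exprVn -!exprM mulnC.
rewrite ltr_pdivlMr ?exprn_gt0// mulrAC -ltr_pdivlMr ?exprn_gt0//.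
have -> : n.+1%:R * (N%:R ^+ n * N%:R ^+ n) * (lam ^+ d) ^+ n = n.+1%:R * q ^+ n :> R.
  by rewrite -exprMn -expr2 -mulrA -exprMn.
have bern : x * n.+1%:R <= (1 + x) ^+ n.
  apply: le_trans (bernoulli n (ltW x0)); rewrite -natr1 mulrDr mulr1 mulrC; lra.
rewrite -(ltr_pM2l x0) [ltRHS]mulrA -/eta [ltLHS]mulrA.
apply: le_lt_trans (_ : (1 + x) ^+ n * q ^+ n < _).
  by rewrite ler_wpM2r// exprn_ge0.
by rewrite -exprMn (le_lt_trans (ler_norm _) yn).
Qed.

End GridSize.

(** * Choice of the translations *)

Section Selection.
Variables (R : realType) (d N : nat) (Omega : set 'rV[R]_d).
Local Notation V := 'rV[R]_d.
Variables (b p : 'I_N.+1 -> V) (k : 'I_N.+1 -> R) (Oi : 'I_N.+1 -> 'M[R]_d).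
Variables (lam rho D eps R1 : R).

(* Keeps the translations in the ball of radius [eps] without a subtype. *)
Definition clip (v : V) : V := if enorm v <= eps then v else 0.

Local Notation word_pole := (@word_pole R d 'I_N.+1 V b p k Oi clip).

Hypothesis d0 : (0 < d)%N.
Hypothesis sys : @mixed_system R d Omega 'I_N.+1 V b p k Oi clip lam rho D.
Hypothesis eps0 : 0 < eps.
Hypothesis R10 : 0 < R1.
Hypothesis near : forall w, w <> [::] ->
  @near_pole R d Omega 'I_N.+1 V b p k Oi clip R1 w.
Hypothesis dim : N.+1%:R ^+ 2 * lam ^+ d < 1.

Local Notation gap := (pole_gap lam rho D).
Let theta := lam * ((R1 / gap) ^+ 2 / (1 - lam)).
Hypothesis transversal : theta < 1.

Definition shifted (sg : 'I_N.+1 -> V) (w : seq 'I_N.+1) := [seq (i, sg i) | i <- w].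

Definition gridpt (h : R) (M : nat) (t : {ffun 'I_d -> 'I_M}) : V :=
  \row_j (h * (t j)%:R).

Lemma enorm_gridpt_le h M (t : {ffun 'I_d -> 'I_M}) : 0 <= h ->
  enorm (gridpt h t) <= d%:R * (h * M%:R).
Proof.
move=> h0; apply: le_trans (enorm_le_sum _) _.
apply: (@le_trans _ _ (\sum_(j < d) h * M%:R)); last first.
  by rewrite sumr_const card_ord mulr_natl.
apply: ler_sum => j _; rewrite !mxE ger0_norm ?mulr_ge0// ler_wpM2l// ler_nat.
exact: ltnW.
Qed.

Lemma gridpt_sep h M (t t' : {ffun 'I_d -> 'I_M}) : 0 < h -> t != t' ->
  h <= enorm (gridpt h t - gridpt h t').
Proof.
move=> h0 tt'; have [j tj] : exists j, t j != t' j.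
  apply/existsP; apply: contraR tt'; rewrite negb_exists => /forallP e.
  by apply/eqP/ffunP => j; have := e j; rewrite negbK => /eqP.
apply: le_trans (coord_le_enorm _ j); rewrite !mxE -mulrBr normrM gtr0_norm//.
rewrite ler_peMr ?(ltW h0)//.
have: (t j : nat) != t' j by [].
rewrite neq_ltn => /orP[] lt; [rewrite distrC|];
  by rewrite -natrB ?(ltnW lt)// normr_nat ler1n subn_gt0.
Qed.

Lemma word_pole_line (sg sg' : 'I_N.+1 -> V) (v : V) i w : 0 <= enorm v ->
  (forall c, enorm (clip (sg c) - clip (sg' c)) <= enorm v) ->
  enorm (word_pole (shifted sg (i :: w)) - word_pole (shifted sg' (i :: w)) -
    (clip (sg i) - clip (sg' i))) <= theta * enorm v.
Proof.
move=> v0 hv.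
have E : shifted sg (i :: w) = left_word [seq (c, sg c, sg' c) | c <- i :: w].
  by rewrite /left_word -map_comp.
have E' : shifted sg' (i :: w) = right_word [seq (c, sg c, sg' c) | c <- i :: w].
  by rewrite /right_word -map_comp.
have := @word_pole_perturb _ _ _ _ _ _ _ _ _ _ _ _ _ sys R1 xpredT
  (fun w w0 _ => near w0) (enorm v) i (sg i) (sg' i) [seq (c, sg c, sg' c) | c <- w].
rewrite E E' => /(_ _ _)/le_trans -> //; first exact: all_predT.
  by rewrite -[_ :: _]/([seq (c, sg c, sg' c) | c <- i :: w]) all_map; apply/allP => c _ /=.
by rewrite /theta -!mulrA le_eqVlt; apply/orP; left; apply/eqP; ring.
Qed.

Lemma pole_separation : exists sg : 'I_N.+1 -> V,
  (forall c, enorm (sg c) <= eps) /\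
  exists2 c, 0 < c & forall i j w w', i != j -> size w = size w' ->
    c <= enorm (word_pole (shifted sg (i :: w)) - word_pole (shifted sg (j :: w'))).
Proof.
have gap0 := pole_gap_gt0 sys; have lam0 := ms_lam_gt0 sys.
pose A := R1 ^+ 2 / gap.
have A0 : 0 < A by rewrite divr_gt0// exprn_gt0.
have dR : 0 < d%:R :> R by rewrite ltr0n.
have th0 : 0 < 1 - theta by rewrite subr_gt0.
(* For the mesh [h] below, the bound [M.+1%:R * lam ^+ n < B] is exactly
   [delta < (1 - theta) * h]. *)
pose B := (1 - theta) * eps / (3 * d%:R * A).
have B0 : 0 < B by rewrite divr_gt0 ?(mulr_gt0 th0 eps0)// (mulr_gt0 _ A0)// (mulr_gt0 _ dR).
have [n [M [n0 hM hcard]]] := grid_size d0 lam0 (ms_lam_lt1 sys) B0 dim.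
have ln0 : 0 < lam ^+ n by rewrite exprn_gt0.
pose h := eps / (d%:R * M.+1%:R).
have h0 : 0 < h by rewrite divr_gt0// mulr_gt0// ltr0n.
(* Truncating two long words to length n costs A lam^n each; the third A lam^n is the separation
   that remains. *)
pose delta := 3 * A * lam ^+ n.
have hdelta : delta < (1 - theta) * h.
  move: hM; rewrite /B /delta /h => hM.
  rewrite [ltRHS]mulrA ltr_pdivlMr; last by rewrite mulr_gt0// ltr0n.
  move: hM; rewrite ltr_pdivlMr; last by rewrite (mulr_gt0 _ A0)// (mulr_gt0 _ dR).
  lra.
pose grid := {ffun 'I_N.+1 -> {ffun 'I_d -> 'I_M.+1}}.
pose sg (t : grid) c := gridpt h (t c).
have clipE (t : grid) c : clip (sg t c) = sg t c.
  rewrite /clip ifT// (le_trans (enorm_gridpt_le _ (ltW h0)))//.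
  by rewrite le_eqVlt /h; apply/orP; left; apply/eqP; field; rewrite !gt_eqF ?ltr0n.
pose P (t : grid) (w : seq 'I_N.+1) := word_pole (shifted (sg t) w).
(* A length m <= n and two words of length n, whose prefixes of length m are compared: this encodes
   all pairs of equal length up to n in one finite type. *)
pose key := ('I_n.+1 * (n.-tuple 'I_N.+1 * n.-tuple 'I_N.+1))%type.
pose badp (u u' : seq 'I_N.+1) (t : grid) :=
  if (u, u') is (i :: w, j :: w') then
    (i != j) && (enorm (P t (i :: w) - P t (j :: w')) <= delta) else false.
pose bad (x : key) : {set grid} := finset (badp (take x.1 x.2.1) (take x.1 x.2.2)).
have hbad x : (#|bad x| <= (M.+1.*2 ^ d) ^ N)%N.
  have bad0 u u' : (forall t, badp u u' t = false) -> #|finset (badp u u')| = 0%N.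
    by move=> u0; apply/eqP; rewrite cards_eq0; apply/eqP/setP => t; rewrite !inE u0.
  rewrite /bad; case: (take _ _) => [|i w]; first by rewrite bad0.
  case: (take _ _) => [|j w']; first by rewrite bad0.
  have [->|ij] := eqVneq i j; first by rewrite bad0// => t; rewrite /badp eqxx.
  apply: (card_line_free ij) => t t'; rewrite !inE => /andP[_ ht] /andP[_ ht'] same sum.
  pose v := sg t i - sg t' i.
  have vj : sg t j - sg t' j = - v.
    apply/rowP => c; rewrite !mxE; have := sum c.
    move/(congr1 (fun m => h * m%:R : R)); rewrite !natrD !mulrDr; lra.
  have hc c : enorm (clip (sg t c) - clip (sg t' c)) <= enorm v.
    rewrite !clipE; have [->//|ci] := eqVneq c i.
    have [->|cj] := eqVneq c j; first by rewrite vj enormN.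
    by rewrite /sg same// subrr enorm0 enorm_ge0.
  have := word_pole_line i w (enorm_ge0 v) hc; have := word_pole_line j w' (enorm_ge0 v) hc.
  rewrite !clipE vj -/v -/(P t (j :: w')) -/(P t' (j :: w')) -/(P t (i :: w)) -/(P t' (i :: w)).
  move: (P t (j :: w')) (P t' (j :: w')) (P t (i :: w)) (P t' (i :: w)) ht ht'.
  move=> y y' x1 x' ht ht' e1 e2.
  (* Between [t] and [t'] the difference of the two poles changes by 2v up to an error 2 theta |v|,
     but it has norm at most [delta] at both. Hence (1 - theta)|v| <= delta < (1 - theta) h, and
     distinct grid points are at least [h] apart. *)
  have vlt : enorm v < h.
    have : enorm (2 *: v) <= 2 * delta + 2 * (theta * enorm v).
      have -> : 2 *: v = ((x1 - y) - (x' - y')) - ((x1 - x' - v) - (y - y' - - v)).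
        by apply/rowP => c; rewrite !mxE; ring.
      have := ler_enormB (x1 - y - (x' - y')) (x1 - x' - v - (y - y' - - v)).
      have := ler_enormB (x1 - y) (x' - y').
      have := ler_enormB (x1 - x' - v) (y - y' - - v); lra.
    rewrite enormZ ger0_norm// => hv.
    by rewrite -(ltr_pM2l th0); lra.
  have ti : t i = t' i.
    by apply/eqP; apply: contraLR vlt => /(gridpt_sep h0); rewrite -leNgt.
  apply/ffunP => c; have [->//|ci] := eqVneq c i.
  have [->|cj] := eqVneq c j; last exact: same.
  by apply/ffunP => e; apply: val_inj; have := sum e; rewrite ti => /addnI.
have [t ht] : exists t : grid, forall x, t \notin bad x.
  apply: (union_bound hbad).
  rewrite !card_prod !card_tuple !card_ffun !card_ord.
  have -> : ((M.+1.*2 ^ d) ^ N = 2 ^ (d * N) * (M.+1 ^ d) ^ N)%N.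
    by rewrite -mul2n expnMn expnMn expnM.
  rewrite expnS mulnA ltn_pmul2r ?expn_gt0//; apply: leq_ltn_trans hcard.
  (* [grid_size] was applied with [N.+1] letters and allows 2^(d(N+1)), whereas the line argument
     costs only 2^(dN). *)
  by apply: leq_mul => //; rewrite leq_exp2l// leq_mul2l leqnSn orbT.
exists (sg t); split=> [c|].
  by rewrite -clipE /clip; case: ifPn => [//|_]; rewrite enorm0 ltW.
exists (A * lam ^+ n); first by rewrite mulr_gt0.
have short m i j w w' : (m <= n)%N -> i != j -> size (i :: w) = m -> size (j :: w') = m ->
    delta < enorm (P t (i :: w) - P t (j :: w')).
  move=> mn ij sw sw'.
  have pad u : size u = m -> {x : n.-tuple 'I_N.+1 | take m x = u}.
    move=> su; have sx : size (u ++ nseq (n - m) i) == n.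
      by rewrite size_cat size_nseq su subnKC.
    by exists (Tuple sx); rewrite /= -su take_size_cat.
  have [x xE] := pad _ sw; have [x' xE'] := pad _ sw'.
  have := ht (inord m, (x, x')); rewrite inE /= inordK ?ltnS// xE xE' /badp ij /=.
  by rewrite -ltNge.
move=> i j w w' ij sw; have sw' : size (i :: w) = size (j :: w') by rewrite /= sw.
rewrite -/(P t (i :: w)) -/(P t (j :: w')).
have [le|lt] := leqP (size (i :: w)) n.
  apply: le_trans (ltW (short _ _ _ _ _ le ij erefl (esym sw'))).
  by rewrite /delta; have := mulr_gt0 A0 ln0; lra.
(* Truncation keeps the first letter, so the prefixes of the two words still begin with different
   letters. *)
have split_w c u : (n < size (c :: u))%N -> exists2 u', size (c :: u') = n &
    enorm (P t (c :: u) - P t (c :: u')) <= A * lam ^+ n.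
  move=> cu; have nE : n = n.-1.+1 by rewrite prednK.
  have su : size (c :: take n.-1 u) = n.
    by rewrite [RHS]nE /= size_take ifT//; move: cu; rewrite [n in (n < _)%N]nE.
  exists (take n.-1 u) => //.
  rewrite -[in P t (c :: u)](cat_take_drop n.-1 u) -cat_cons /P /shifted map_cat.
  have dn : drop n.-1 u <> [::].
    move=> /(congr1 size); rewrite size_drop => /eqP; rewrite subn_eq0 leqNgt.
    by move: cu; rewrite [n in (n < _)%N]nE /= ltnS => ->.
  rewrite mulrC -[in lam ^+ n]su -(size_map (fun i => (i, sg t i))).
  apply: (word_pole_cat_near sys) => //; last exact: near.
  by case: (drop _ _) dn.
have [u su hu] := split_w _ _ lt.
rewrite sw' in lt; have [u' su' hu'] := split_w _ _ lt.
have := short n i j u u' (leqnn n) ij su su'.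
have := ler_enorm_dist (P t (j :: w')) (P t (i :: u)) (P t (j :: u')).
have := ler_enorm_dist (P t (i :: w)) (P t (i :: u)) (P t (j :: w')).
rewrite (enormB (P t (i :: u)) (P t (i :: w))) /delta.
by move: hu hu' => *; lra.
Qed.

End Selection.

(** * Topology and extended suprema *)

Section Topology.
Variables (R : realType) (d : nat).
Local Notation V := 'rV[R]_d.
Implicit Types (x y z : V) (A : set V).

Lemma nbhs_enorm_ball x (e : R) : 0 < e -> \forall y \near x, enorm (y - x) < e.
Proof.
move=> e0; have d1 : 0 < d%:R + 1 :> R by rewrite ltr_wpDl.
have e1 : 0 < e / (d%:R + 1) by rewrite divr_gt0.
apply: filterS (nbhsx_ballx x _ e1) => y; rewrite -ball_normE /= distrC => xy.
apply: le_lt_trans (enorm_le_mxnorm _) _.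
apply: le_lt_trans (_ : (d%:R + 1) * `|y - x| < _); first by rewrite ler_wpM2r// lerDl.
by rewrite mulrC -ltr_pdivlMr.
Qed.

Lemma nbhs_enormP x A : nbhs x A <->
  exists2 e : R, 0 < e & forall y, enorm (y - x) <= e -> A y.
Proof.
split=> [/nbhs_ballP[e /= e0 h]|[e e0 h]].
  exists (e / 2) => [|y xy]; first by rewrite divr_gt0.
  apply: h; rewrite -ball_normE /= distrC (le_lt_trans (mxnorm_le_enorm _))//.
  by rewrite (le_lt_trans xy)// ltr_pdivrMr// ltr_pMr// ltr1n.
by apply: filterS (nbhs_enorm_ball x e0) => y /ltW; exact: h.
Qed.

Lemma uniform_cvg_enorm A (u : nat -> V -> V) (f : V -> V) :
  {uniform A, u @ \oo --> f} <->
  forall e : R, 0 < e -> \forall n \near \oo, forall x, A x -> enorm (u n x - f x) < e.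
Proof.
split=> [uf e e0|h].
  have d1 : 0 < d%:R + 1 :> R by rewrite ltr_wpDl.
  have e1 : 0 < e / (d%:R + 1) by rewrite divr_gt0.
  have /uf : nbhs (f : {uniform` A -> V})
      [set g | forall y, A y -> ball (f y) (e / (d%:R + 1)) (g y)].
    apply/uniform_nbhs; exists [set xy | ball xy.1 (e / (d%:R + 1)) xy.2]; split=> //.
    exact: (entourage_ball _ (PosNum e1)).
  move=> H; have {}H : \forall n \near \oo,
    forall y, A y -> ball (f y) (e / (d%:R + 1)) (u n y) by exact: H.
  apply: filterS H => n un x Ax; have := un x Ax; rewrite -ball_normE /= distrC => xy.
  apply: le_lt_trans (enorm_le_mxnorm _) _.
  apply: le_lt_trans (_ : (d%:R + 1) * `|u n x - f x| < _).
    by rewrite ler_wpM2r// lerDl.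
  by rewrite mulrC -ltr_pdivlMr.
move=> P /uniform_nbhs[E [entE sub]].
have : exists2 e : R, 0 < e & [set xy : V * V | ball xy.1 e xy.2] `<=` E.
  by move: entE; rewrite -entourage_ballE => -[e /= e0 he]; exists e.
move=> [e e0 he]; apply: filterS (h e e0) => n un; apply: sub => y Ay.
apply: he; rewrite -ball_normE /= distrC.
exact: le_lt_trans (mxnorm_le_enorm _) (un y Ay).
Qed.

Lemma enorm_cauchy_cvg (u : nat -> V) :
  (forall e : R, 0 < e -> exists n, forall m, (n <= m)%N -> enorm (u m - u n) < e) ->
  exists q, forall e : R, 0 < e -> \forall n \near \oo, enorm (u n - q) < e.
Proof.
move=> h; have /cauchy_cvgP/cvg_ex[q uq] : cauchy (u @ \oo).
  apply: cauchy_exP => e e0; have [n hn] := h e e0; exists (u n).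
  exists n => // m /= nm; rewrite -ball_normE /= distrC.
  exact: le_lt_trans (mxnorm_le_enorm _) (hn m nm).
by exists q => e e0; have := uq _ (nbhs_enorm_ball q e0).
Qed.

(** Otherwise [A] would cut out a proper nonempty clopen part of the segment from [x] to [y]. This
    turns distances to the frontier, as in [rho_b], into distances to the complement. *)
Lemma frontier_between A x y : open A -> A x -> ~ A y ->
  exists2 z, frontier A z & enorm (z - x) <= enorm (y - x).
Proof.
move=> oA Ax nAy; apply: contrapT => nz.
pose g (t : R) : V := x + t *: (y - x).
have cg : continuous g.
  have -> : g = cst x + (fun t : R => t *: (y - x)) by [].
  by move=> t; apply: continuousD; [exact: cvg_cst|exact: scalel_continuous].
have hc : connected (g @` `[0, 1]%classic).
  apply: connected_continuous_connected; first exact: segment_connected.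
  exact: continuous_subspaceT.
have gx : (g @` `[0, 1]%classic) x.
  by exists 0; rewrite /= ?in_itv/= ?lexx ?ler01// /g scale0r addr0.
have gy : (g @` `[0, 1]%classic) y.
  by exists 1; rewrite /= ?in_itv/= ?lexx ?ler01// /g scale1r addrC subrK.
have := hc ((g @` `[0, 1]%classic) `&` A) => /(_ _ _ _) E.
suff : ((g @` `[0, 1]%classic) `&` A) y by case.
rewrite E//; first by exists x.
  by exists A.
exists (closure A); first exact: closed_closure.
apply/seteqP; split=> z [gz Az]; split=> //; first exact: subset_closure.
apply: contrapT => nAz; apply: nz; exists z.
  by split=> //; move: oA => /interior_id ->.
case: gz => t; rewrite /= in_itv/= => /andP[t0 t1] <-.
by rewrite /g addrC addKr enormZ ger0_norm// ler_piMl// enorm_ge0.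
Qed.

(** Half of a local radius works on a whole neighbourhood, and compactness in near-covering form
    makes it uniform. The margin is the room for moving a generator without leaving [Omega]. *)
Lemma compact_image_margin (K A : set V) (f : V -> V) : compact K -> open A ->
  (forall x, K x -> {for x, continuous f}) -> f @` K `<=` A ->
  exists2 e : R, 0 < e & forall x y, K x -> enorm (y - f x) <= e -> A y.
Proof.
move=> /compact_near_coveringP cK oA cf fA.
have : \forall e \near (0 : R)^'+, K `<=` [set x | forall y, enorm (y - f x) <= e -> A y].
  apply: cK => x Kx.
  have /nbhs_enormP[e e0 he] : nbhs (f x) A.
    by apply: open_nbhs_nbhs; split=> //; apply: fA; exists x.
  have e2 : 0 < e / 2 by rewrite divr_gt0.
  exists ([set z | enorm (f z - f x) < e / 2], [set t | t < e / 2]).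
    split; last exact: nbhs_right_lt.
    exact: (cf x Kx _ (nbhs_enorm_ball (f x) e2)).
  move=> [z t] /= [h1 h2] y h3; apply: he.
  by have := ler_enorm_dist (f z) y (f x); lra.
move=> h; have /filter_ex[e [e0 he]] : \forall e \near (0 : R)^'+,
    0 < e /\ K `<=` [set x | forall y, enorm (y - f x) <= e -> A y].
  by apply: filterS2 (nbhs_right_gt 0) h => e.
by exists e => // x y Kx; exact: he.
Qed.

Lemma bounded_enorm A : bounded_set A ->
  exists2 C : R, 0 <= C & forall x y, closure A x -> closure A y -> enorm (x - y) <= C.
Proof.
move=> [M [_ hM]]; pose C := Num.max 0 (M + 1).
have C0 : 0 <= C by rewrite le_max lexx.
have AC x : A x -> `|x| <= C.
  by move=> Ax; rewrite le_max (hM (M + 1)) ?orbT// ltrDl.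
have clC x : closure A x -> enorm x <= d%:R * C + 1.
  move=> /(_ _ (nbhs_enorm_ball x ltr01))[y [Ay xy]].
  have := ler_enormB y (y - x); rewrite subKr.
  have := enorm_le_mxnorm y; have := ler_wpM2l (ler0n R d) (AC y Ay); lra.
exists (2 * (d%:R * C + 1)) => [|x y /clC cx /clC cy].
  by rewrite mulr_ge0// addr_ge0// mulr_ge0.
by have := ler_enormB x y; lra.
Qed.

Lemma compact_closure_bounded A : bounded_set A -> compact (closure A).
Proof.
move=> bA; have [C C0 hC] := bounded_enorm bA.
have [->|/set0P[a Aa]] := eqVneq (closure A) set0; first exact: compact0.
apply: bounded_closed_compact; last exact: closed_closure.
exists (C + enorm a); split; first exact: num_real.
move=> t /ltW Ct x Ax; apply: le_trans Ct.
apply: le_trans (mxnorm_le_enorm _) _.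
by have := ler_enormD (x - a) a; rewrite subrK; have := hC x a Ax Aa; lra.
Qed.

(** The conditions on the relaxed constants are strict polynomial inequalities in a small parameter,
    so each persists near 0. *)
Lemma poly_lt_near (p q : {poly R}) : p.[0] < q.[0] ->
  \forall t \near (0 : R)^'+, p.[t] < q.[t].
Proof.
move=> pq; apply: cvg_within.
have : {for 0, continuous (horner (q - p))} by exact: continuous_horner.
rewrite /prop_for /continuous_at => h.
have : 0 < (q - p).[0] by rewrite hornerD hornerN subr_gt0.
move=> /(cvgr_gt _ h); apply: filterS => t.
by rewrite hornerD hornerN subr_gt0.
Qed.

End Topology.

Section ExtendedBounds.
Variables (R : realType) (d : nat).
Local Notation V := 'rV[R]_d.

(** [fine] sends infinite values to 0, so some finite bound [C] is required before the supremum can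
    be used as a real number. *)
Lemma fine_bigmax_esup N (A : set V) (f : 'I_N -> V -> R) (C : R) :
  (forall i x, A x -> f i x <= C) ->
  forall i x, A x ->
  f i x <= fine (\big[maxe/-oo%E]_(i < N) esup_on A (f i)).
Proof.
move=> fC i x Ax; set e := \big[_/_]_(_ < _) _.
have le1 : ((f i x)%:E <= e)%E.
  apply: le_trans (le_bigmax _ _ i); apply: ereal_sup_ubound.
  by exists x.
have le2 : (e <= C%:E)%E.
  apply: bigmax_le => [|j _]; first exact: leNye.
  by apply: ge_ereal_sup => _ [y Ay <-]; rewrite lee_fin fC.
have fe : e \is a fin_num.
  by rewrite fin_numE gt_eqF ?lt_eqF//= ?(lt_le_trans _ le1) ?(le_lt_trans le2) ?ltNyr ?ltry.
by rewrite -lee_fin fineK.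
Qed.

Lemma fine_le (e : \bar R) (r : R) : 0 <= r -> (e <= r%:E)%E -> fine e <= r.
Proof. by case: e => [s|//|//] _; rewrite lee_fin. Qed.

Lemma point_dist_le (x y : V) A : A y -> (point_dist (Some x) A <= (enorm (x - y))%:E)%E.
Proof. by move=> Ay; apply: ereal_inf_lbound; exists y. Qed.

Lemma point_dist_ge0 (q : extended_space R d) (A : set V) : (0 <= point_dist q A)%E.
Proof.
case: q => [x|]; last exact: leey.
by apply: le_ereal_inf_tmp => _ [y _ <-]; rewrite lee_fin enorm_ge0.
Qed.

Lemma point_dist_gt (x : V) (A : set V) : (0 < point_dist (Some x) A)%E ->
  exists2 c : R, 0 < c & forall y, A y -> c <= enorm (x - y).
Proof.
move=> h; have : point_dist (Some x) A = +oo%E \/ point_dist (Some x) A \is a fin_num.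
  by move: h; case: point_dist => [r||] //; [right|left].
case=> [E|F].
  exists 1 => // y Ay; have := point_dist_le x Ay; rewrite E.
  by rewrite leye_eq.
exists (fine (point_dist (Some x) A)) => [|y Ay].
  by rewrite -lte_fin fineK.
by rewrite -lee_fin fineK//; exact: point_dist_le.
Qed.

End ExtendedBounds.

(** * Separated poles give separated T *)

Section SeparatedSystem.
Variables (R : realType) (d N : nat) (Omega Omega' : set 'rV[R]_d).
Local Notation V := 'rV[R]_d.
Local Notation Vh := (extended_space R d).
Variables (b p : 'I_N.+1 -> V) (k : 'I_N.+1 -> R) (Oi : 'I_N.+1 -> 'M[R]_d).
Variables (lam rho D eps R1 : R) (sg : 'I_N.+1 -> V).

Local Notation word_pole := (@word_pole R d 'I_N.+1 V b p k Oi (clip eps)).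
Local Notation Fw := (@word_fun R d 'I_N.+1 V b p k Oi (clip eps)).
Local Notation letter_map := (@letter_map R d 'I_N.+1 V b p k Oi (clip eps)).

Hypothesis d0 : (0 < d)%N.
Hypothesis sys : @mixed_system R d Omega 'I_N.+1 V b p k Oi (clip eps) lam rho D.
Hypothesis near : forall w, w <> [::] ->
  @near_pole R d Omega 'I_N.+1 V b p k Oi (clip eps) R1 w.

Definition shifted_system (i : 'I_N.+1) : Vh -> Vh := letter_map (i, sg i).
Local Notation Psi := shifted_system.
Local Notation P w := (word_pole (shifted sg w)).

Lemma word_map_shifted w : word_map Psi w = Fw (shifted sg w).
Proof.
rewrite /word_map /word_fun /shifted; elim: w (@id Vh) => [//|i w IH] h /=.
exact: IH.
Qed.

Lemma shifted_neq0 (w : seq 'I_N.+1) : w <> [::] -> shifted sg w <> [::].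
Proof. by case: w. Qed.

Lemma T_fin_shifted w x : w <> [::] -> closure Omega x ->
  T_fin Psi w x = -2 *: sphinv (x - P w).
Proof.
move=> /shifted_neq0 w0 Ox; rewrite /T_fin word_map_shifted.
have [bw [kw [Ow [[kw0 hO -> _] _]]]] := word_dataN0 sys w0.
apply: grad_log_invmap => //.
exact: enorm_sub_gt0 (pole_dist_gt0 sys) (word_pole_far sys w0 Ox).
Qed.

Let gap := D * (1 - lam).
Let A := R1 ^+ 2 / pole_gap lam rho D.

Lemma enorm_sphinvB_le (x y z : V) : gap <= enorm (x - y) -> gap <= enorm (x - z) ->
  enorm (-2 *: sphinv (x - y) - -2 *: sphinv (x - z)) <= 2 * enorm (y - z) / gap ^+ 2.
Proof.
have gap0 : 0 < gap := pole_dist_gt0 sys.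
move=> hy hz; have [y0 z0] := (enorm_sub_gt0 gap0 hy, enorm_sub_gt0 gap0 hz).
rewrite -scalerBr enormZ normrN ger0_norm// enorm_sphinvB ?subr_eq0//.
rewrite opprB [x - y + _]addrC addrA subrK (enormB z) mulrA.
apply: ler_wpM2l; first by rewrite mulr_ge0// enorm_ge0.
rewrite lef_pV2 ?posrE ?exprn_gt0// ?mulr_gt0 ?(lt_le_trans gap0)//.
by rewrite expr2 ler_pM// ltW.
Qed.

Lemma word_pole_prefix_cauchy (u : nat -> 'I_N.+1) n m : (0 < n)%N -> (n <= m)%N ->
  enorm (P (mkseq u m) - P (mkseq u n)) <= lam ^+ n * A.
Proof.
move=> n0 nm; rewrite -(subnKC nm); have A0 : 0 <= A.
  by rewrite divr_ge0 ?sqr_ge0// ltW// (pole_gap_gt0 sys).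
have l0 := ms_lam_gt0 sys.
have un0 : mkseq u n <> [::] by case: n n0 nm.
rewrite {1}/mkseq iotaD map_cat /shifted map_cat add0n.
case E: (m - n)%N => [|r].
  by rewrite /= cats0 subrr enorm0 mulr_ge0// exprn_ge0// ltW.
have sz : size (shifted sg (mkseq u n)) = n by rewrite size_map size_mkseq.
rewrite -[in lam ^+ n]sz; apply: (word_pole_cat_near sys) => //.
  exact: shifted_neq0.
by apply: near; exact: shifted_neq0.
Qed.

(** [T_inf] is a chosen limit, so existence has to be shown. Poles of prefixes form a Cauchy
    sequence, and its limit inherits the distance [gap] from the closure, where [sphinv] depends
    uniformly on the pole. *)
Lemma T_inf_cvg (u : nat -> 'I_N.+1) :
  {uniform closure Omega, (fun n => T_fin Psi (mkseq u n)) @ \oo --> T_inf Omega Psi u}.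
Proof.
have gap0 : 0 < gap := pole_dist_gt0 sys.
have l0 := ms_lam_gt0 sys; have l1 := ms_lam_lt1 sys.
have A0 : 0 <= A by rewrite divr_ge0 ?sqr_ge0// ltW// (pole_gap_gt0 sys).
have [q hq] : exists q, forall e : R, 0 < e ->
    \forall n \near \oo, enorm (P (mkseq u n) - q) < e.
  apply: enorm_cauchy_cvg => e e0.
  have /cvg_expr/cvgr0_norm_lt hl : `|lam| < 1 by rewrite gtr0_norm.
  have eA : 0 < e / (A + 1) by rewrite divr_gt0// ltr_wpDl.
  have /filter_ex[n [n0 ln]] : \forall n \near \oo, (0 < n)%N /\ `|lam ^+ n| < e / (A + 1).
    by apply: filterS2 (nbhs_infty_gt 0) (hl _ eA) => n.
  exists n => m nm; apply: le_lt_trans (word_pole_prefix_cauchy u n0 nm) _.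
  move: ln; rewrite gtr0_norm ?exprn_gt0// ltr_pdivlMr ?ltr_wpDl//.
  by have := exprn_gt0 n l0; lra.
have far n x : (0 < n)%N -> closure Omega x -> gap <= enorm (x - P (mkseq u n)).
  by move=> n0 Ox; apply: (word_pole_far sys) => //; case: n n0.
have farq x : closure Omega x -> gap <= enorm (x - q).
  move=> Ox; apply/ler_addgt0Pr => e e0.
  have /filter_ex[n [n0 hn]] : \forall n \near \oo, (0 < n)%N /\ enorm (P (mkseq u n) - q) < e.
    by apply: filterS2 (nbhs_infty_gt 0) (hq _ e0) => n.
  have := far n x n0 Ox; have := ler_enorm_dist q x (P (mkseq u n)).
  by rewrite (enormB q); lra.
rewrite /T_inf; apply: (@xgetPex _ _ [set f : V -> V | {uniform closure Omega,
  (fun n => T_fin Psi (mkseq u n)) @ \oo --> f}]).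
exists (fun x => -2 *: sphinv (x - q)) => /=.
apply/uniform_cvg_enorm => e e0.
have e1 : 0 < e * gap ^+ 2 / 2 by rewrite divr_gt0// mulr_gt0// exprn_gt0.
apply: filterS2 (nbhs_infty_gt 0) (hq _ e1) => n n0 hn x Ox.
rewrite T_fin_shifted//; last by case: n n0 {hn}.
apply: le_lt_trans (enorm_sphinvB_le (far n x n0 Ox) (farq x Ox)) _.
by rewrite ltr_pdivrMr ?exprn_gt0//; lra.
Qed.

Hypothesis Om0 : Omega !=set0.
Hypothesis bOm : bounded_set Omega.

(** A single point [x0] of [Omega] suffices: there |T_w - T_w'| = 2|p_w - p_w'| / (|x0 - p_w| |x0 -
    p_w'|), and the poles stay within distance [L] of [x0]. The constant is independent of the
    length, so it passes to infinite words. *)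
Lemma separated_G_T (c : R) : is_cifs Omega Omega' Psi -> 0 < c ->
  (forall i j w w', i != j -> size w = size w' -> c <= enorm (P (i :: w) - P (j :: w'))) ->
  G_T Omega Omega' Psi.
Proof.
move=> cifs c0 sep; split=> //.
have gap0 : 0 < gap := pole_dist_gt0 sys.
have [x0 Ox] := Om0; have clx : closure Omega x0 by exact: subset_closure.
have [B B0 hB] := bounded_enorm bOm.
pose L := B + `|R1| + 1.
have L0 : 0 < L by rewrite /L ltr_wpDl// addr_ge0.
have hL w : w <> [::] -> enorm (x0 - P w) <= L.
  move=> /shifted_neq0/near[x Ocx hx].
  have := ler_enorm_dist x x0 (P w); have := hB x0 x clx Ocx.
  by have := ler_norm R1; rewrite /L; lra.
pose c' := 2 * c / L ^+ 2.
have c'0 : 0 < c' by rewrite divr_gt0 ?mulr_gt0// exprn_gt0.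
have fin i j w w' : i != j -> size w = size w' ->
    c' <= enorm (T_fin Psi (i :: w) x0 - T_fin Psi (j :: w') x0).
  move=> ij sw; rewrite !T_fin_shifted//.
  have cw (w1 : seq 'I_N.+1) : w1 <> [::] -> x0 != P w1.
    by move=> /shifted_neq0 h; exact: enorm_sub_gt0 gap0 (word_pole_far sys h clx).
  have [h1 h2] : x0 != P (i :: w) /\ x0 != P (j :: w') by split; exact: cw.
  rewrite -scalerBr enormZ normrN ger0_norm// enorm_sphinvB ?subr_eq0//.
  rewrite opprB [x0 - _ + _]addrC addrA subrK (enormB (P (j :: w'))) /c' -mulrA.
  rewrite ler_pM2l//; apply: ler_pM; [exact: ltW|by rewrite invr_ge0 sqr_ge0|exact: sep|].
  rewrite lef_pV2 ?posrE ?exprn_gt0// ?mulr_gt0 ?enorm_gt0 ?subr_eq0//.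
  by rewrite expr2 ler_pM ?enorm_ge0 ?hL.
apply: lt_le_trans (_ : (c'%:E <= _)%E); first by rewrite lte_fin.
apply: le_ereal_inf_tmp => _ [[w w'] /= [sw w0 fw] <-].
apply: le_trans (ereal_sup_ubound _); last by exists x0.
rewrite lee_fin; case: w w' sw w0 fw => [w|u] [w'|u'] //=.
  case: w => [|i w]; first by move=> _ [].
  case: w' => [|j w'] // [sw] _ ij; apply: fin => //.
  by apply: contra_not_neq ij => ->.
move=> _ _ uu'; apply/ler_addgt0Pr => e e0.
have e2 : 0 < e / 2 by rewrite divr_gt0.
have /uniform_cvg_enorm/(_ _ e2) h := @T_inf_cvg u.
have /uniform_cvg_enorm/(_ _ e2) h' := @T_inf_cvg u'.
have /filter_ex[n [n0 hn hn']] : \forall n \near \oo, [/\ (0 < n)%N,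
    enorm (T_fin Psi (mkseq u n) x0 - T_inf Omega Psi u x0) < e / 2 &
    enorm (T_fin Psi (mkseq u' n) x0 - T_inf Omega Psi u' x0) < e / 2].
  by apply: filterS3 (nbhs_infty_gt 0) h h' => n n0 hn hn'; split=> //; [exact: hn|exact: hn'].
have : c' <= enorm (T_fin Psi (mkseq u n) x0 - T_fin Psi (mkseq u' n) x0).
  case: n n0 {hn hn'} => // n _; rewrite /mkseq /=; apply: fin.
    by apply: contra_not_neq uu' => ->.
  by rewrite !size_map.
move: hn hn'; move: (T_fin _ _ _) (T_fin _ _ _) (T_inf _ _ _ _) (T_inf _ _ _ _) => a' a t' t hn hn'.
have := ler_enorm_dist t a a'; have := ler_enorm_dist t' t a'.
by rewrite (enormB t' a'); lra.
Qed.

End SeparatedSystem.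

(** * The pole constants *)

Section PoleConstants.
Variables (R : realType) (d N : nat) (Omega : set 'rV[R]_d).
Local Notation V := 'rV[R]_d.
Local Notation Vh := (extended_space R d).
Variables (b p : 'I_N.+1 -> V) (k : 'I_N.+1 -> R) (Oi : 'I_N.+1 -> 'M[R]_d).
Hypothesis d0 : (0 < d)%N.
Hypothesis k0 : forall i, 0 < k i.
Hypothesis hO : forall i, Oi i *m (Oi i)^T = 1%:M.

Definition inv_system (i : 'I_N.+1) : Vh -> Vh := invmap (b i) (k i) (p i) (Oi i).
Local Notation Phi := inv_system.

Lemma ord_uniform_pos (P : 'I_N.+1 -> R -> Prop) :
  (forall i (e e' : R), 0 < e' -> e' <= e -> P i e -> P i e') ->
  (forall i, exists2 e : R, 0 < e & P i e) ->
  exists2 e : R, 0 < e & forall i, P i e.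
Proof.
move=> mono h.
have : \forall e \near (0 : R)^'+, forall i, P i e.
  apply: filter_forall => i; have [e e0 Pe] := h i.
  apply: filterS2 (nbhs_right_gt 0) (nbhs_right_le e0) => e' e'0 ee'.
  exact: mono Pe.
move=> H; have /filter_ex[e [e0 he]] : \forall e \near (0 : R)^'+,
    0 < e /\ forall i, P i e by apply: filterS2 (nbhs_right_gt 0) H => e.
by exists e.
Qed.

Lemma lambda_max_inv i x : closure Omega x ->
  (forall i x, closure Omega x -> opnorm ('J (finite_part (Phi i)) x) < 1) ->
  x != p i -> k i <= lambda_max Omega Phi * enorm (x - p i) ^+ 2.
Proof.
move=> Ox lt1 xp; rewrite enorm_sqr.
rewrite -ler_pdivrMr ?dot_gt0 ?subr_eq0// -/(qinv (p i) x).
rewrite -(opnorm_jacobian_invmap (b i) d0 (k0 i) (hO i) xp).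
by apply: (fine_bigmax_esup (C := 1)) => // j y Oy; apply/ltW/lt1.
Qed.

Lemma grad_log_inv_le i x (c : R) : 0 < c ->
  (forall i x, closure Omega x -> c <= enorm (x - p i)) -> closure Omega x ->
  2 / enorm (x - p i) <= fine (\big[maxe/-oo%E]_(i < N.+1)
    esup_on (closure Omega) (fun x => enorm (grad_log_D (finite_part (Phi i)) x))).
Proof.
move=> c0 hc Ox.
have gE j y : closure Omega y ->
    enorm (grad_log_D (finite_part (Phi j)) y) = 2 / enorm (y - p j).
  move=> Oy; rewrite grad_log_invmap//; last exact: enorm_sub_gt0 c0 (hc j y Oy).
  by rewrite enormZ normrN ger0_norm// enorm_sphinv.
rewrite -gE//; apply: (fine_bigmax_esup (C := 2 / c)) => // j y Oy; rewrite gE//.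
by rewrite ler_pM2l// lef_pV2 ?posrE ?(lt_le_trans c0 (hc j y Oy))// hc.
Qed.

Hypothesis oOm : open Omega.

Lemma rho_b_le_centre i y : Omega (b i) -> ~ Omega y -> rho_b Omega Phi <= enorm (y - b i).
Proof.
move=> Ob nOy; have [z zF zb] := frontier_between oOm Ob nOy.
apply: fine_le; first exact: enorm_ge0.
apply: le_trans (_ : (_ <= (enorm (z - b i))%:E)%E) _; last by rewrite lee_fin.
rewrite ge_min; apply/orP; left; apply: le_trans (bigmin_le _ i _) _.
by rewrite enormB; exact: point_dist_le.
Qed.

Lemma rho_b_le_image i x y : closure Omega x -> Omega (finite_part (Phi i) x) ->
  ~ Omega y -> rho_b Omega Phi <= enorm (y - finite_part (Phi i) x).
Proof.
move=> Ox Ofx nOy; have [z zF zb] := frontier_between oOm Ofx nOy.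
apply: fine_le; first exact: enorm_ge0.
apply: le_trans (_ : (_ <= (enorm (z - finite_part (Phi i) x))%:E)%E) _; last by rewrite lee_fin.
rewrite ge_min; apply/orP; right; apply: le_trans (bigmin_le _ i _) _.
apply: le_trans (ereal_inf_lbound _) _.
  by exists (finite_part (Phi i) x) => //; exists x.
by rewrite enormB; exact: point_dist_le.
Qed.

(** The bound [C] ensures that the supremum is finite, so that [fine] returns it; [e] replaces
    attainment of the distance. *)
Lemma R_pole_near (C e : R) (q : seq 'I_N.+1 -> V) : 0 < e -> Omega !=set0 ->
  (forall w, w <> [::] -> pole (word_map Phi w) = Some (q w)) ->
  (forall w, w <> [::] -> forall x, closure Omega x -> enorm (q w - x) <= C) ->
  forall w, w <> [::] ->
  exists2 x, closure Omega x & enorm (x - q w) <= R_pole Omega Phi + e.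
Proof.
move=> e0 [x0 Ox0] hq hC w w0; have cx0 : closure Omega x0 by exact: subset_closure.
set s := ereal_sup [set point_dist (pole (word_map Phi s)) (closure Omega)
                  | s in [set s | s <> [::]]].
have le_s u : u <> [::] -> (point_dist (Some (q u)) (closure Omega) <= s)%E.
  by move=> u0; apply: ereal_sup_ubound; exists u => //; rewrite hq.
have sC : (s <= C%:E)%E.
  apply: ge_ereal_sup => _ [u u0 <-]; rewrite hq//.
  by apply: le_trans (point_dist_le _ cx0) _; rewrite lee_fin hC.
have s0 : (0 <= s)%E by apply: le_trans (le_s w w0); exact: point_dist_ge0.
have fs : s \is a fin_num by rewrite ge0_fin_numE// (le_lt_trans sC) ?ltry.
have fd : point_dist (Some (q w)) (closure Omega) \is a fin_num.
  by rewrite ge0_fin_numE ?point_dist_ge0// (le_lt_trans (le_s w w0))// (le_lt_trans sC)// ltry.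
have [_ [x Ox <-] hx] := lb_ereal_inf_adherent e0 fd.
exists x => //; rewrite -lee_fin enormB EFinD /R_pole -/s fineK//.
by apply: le_trans (ltW hx) _; rewrite leeD2r// le_s.
Qed.

End PoleConstants.

Lemma lt_dim_bound (R : realType) (d N : nat) (l : R) : (0 < d)%N -> 0 < l ->
  l < 1 / (N.+1%:R `^ (2 / d%:R)) -> N.+1%:R ^+ 2 * l ^+ d < 1.
Proof.
move=> d0 l0; set a := _ `^ _ => la.
have a0 : 0 < a by rewrite powR_gt0// ltr0n.
have ad : a ^+ d = N.+1%:R ^+ 2.
  rewrite /a -powR_mulrn ?powR_ge0// -powRrM divfK ?pnatr_eq0 -?lt0n//.
  by rewrite powR_mulrn.
rewrite -ad -exprMn exprn_ilt1// ?mulr_ge0 ?(ltW a0) ?(ltW l0)//.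
  by rewrite -lt0n.
by move: la; rewrite ltr_pdivlMr// mulrC.
Qed.

(** * Perturbation of the given system *)

Section Closure.
Variables (R : realType) (d N : nat) (Omega Omega' : set 'rV[R]_d).
Local Notation V := 'rV[R]_d.
Local Notation Vh := (extended_space R d).
Variables (b p : 'I_N.+1 -> V) (k : 'I_N.+1 -> R) (Oi : 'I_N.+1 -> 'M[R]_d).
Local Notation Phi := (inv_system b p k Oi).
Hypothesis d0 : (0 < d)%N.
Hypothesis k0 : forall i, 0 < k i.
Hypothesis hO : forall i, Oi i *m (Oi i)^T = 1%:M.
Hypothesis hOmega : is_domain Omega.
Hypothesis bOm : bounded_set Omega.
Hypothesis hsub : closure Omega `<=` Omega'.
Hypothesis hPhi : is_cifs Omega Omega' Phi.
Hypothesis hpole : forall i, (0 < point_dist (pole (Phi i)) Omega')%E.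
Hypothesis hb : forall i, Omega (b i).

Let lam := lambda_max Omega Phi.
Let rho := rho_b Omega Phi.
Let S0 := fine (\big[maxe/-oo%E]_(i < N.+1)
  esup_on (closure Omega) (fun x => enorm (grad_log_D (finite_part (Phi i)) x))).
Let gap0 := Num.max rho (2 / C_0 Omega Phi).
Let R0 := R_pole Omega Phi.
(** As |grad log|Dphi_i|| = 2/|x - p_i|, this is the least distance from a generator pole to the
    closure. *)
Let Dl := 2 / S0.

Hypothesis hlam1 : lam < 1.
Hypothesis hdim : N.+1%:R ^+ 2 * lam ^+ d < 1.
Hypothesis hK : lam * (gap0 ^+ 2 + R0 ^+ 2) < gap0 ^+ 2.

Lemma inv_pole_away : exists2 c : R, 0 < c &
  forall i y, Omega' y -> c <= enorm (y - p i).
Proof.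
apply: ord_uniform_pos => [i e e' e'0 ee' h y Oy|i]; first exact: le_trans (h y Oy).
have := hpole i; rewrite /inv_system pole_invmap => /point_dist_gt[c c0 hc].
by exists c => // y Oy; rewrite enormB hc.
Qed.

Lemma inv_pole_neq i x : Omega' x -> x != p i.
Proof. by have [c c0 hc] := inv_pole_away => /(hc i)/(enorm_sub_gt0 c0). Qed.

Lemma closure_point : exists x, closure Omega x.
Proof. by have [[x Ox] _ _] := hOmega; exists x; exact: subset_closure. Qed.

Lemma inv_lambda i x : closure Omega x -> k i <= lam * enorm (x - p i) ^+ 2.
Proof.
move=> Ox; apply: lambda_max_inv => //; last exact/inv_pole_neq/hsub.
by move=> j y Oy; have [_ _ _ h] := hPhi j; exact: h.
Qed.

Lemma lam_gt0 : 0 < lam.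
Proof.
have [x Ox] := closure_point.
have := lt_le_trans (k0 ord0) (inv_lambda ord0 Ox).
by rewrite pmulr_lgt0// exprn_gt0// enorm_gt0 subr_eq0; exact/inv_pole_neq/hsub.
Qed.

Lemma inv_grad i x : closure Omega x -> 2 / enorm (x - p i) <= S0.
Proof.
have [c c0 hc] := inv_pole_away; move=> Ox.
by apply: (grad_log_inv_le b d0 k0 hO i c0) => // j y /hsub; exact: hc.
Qed.

Lemma S0_gt0 : 0 < S0.
Proof.
have [x Ox] := closure_point; apply: lt_le_trans (inv_grad ord0 Ox).
by rewrite divr_gt0// enorm_gt0 subr_eq0; exact/inv_pole_neq/hsub.
Qed.

Lemma pole_dist_bound_gt0 : 0 < Dl.
Proof. by rewrite divr_gt0// S0_gt0. Qed.

Lemma pole_dist_bound_le i x : closure Omega x -> Dl <= enorm (x - p i).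
Proof.
move=> Ox; have xp : 0 < enorm (x - p i).
  by rewrite enorm_gt0 subr_eq0; exact/inv_pole_neq/hsub.
by rewrite /Dl ler_pdivrMr ?S0_gt0// mulrC -ler_pdivrMr//; exact: inv_grad.
Qed.

(** Half of the pole distance supplied by [word_dataP]; the spare factor absorbs the relaxation of
    the constants. *)
Lemma two_over_C_0 : 2 / C_0 Omega Phi = Dl * (1 - lam) / 2.
Proof.
rewrite /C_0 -/lam -/S0 /Dl; have := S0_gt0 => s0.
by field; rewrite !gt_eqF// subr_gt0.
Qed.

Lemma gap0_gt0 : 0 < gap0.
Proof.
rewrite lt_max two_over_C_0; apply/orP; right.
by rewrite divr_gt0// mulr_gt0 ?pole_dist_bound_gt0// subr_gt0.
Qed.

Lemma margin : exists2 t : R, 0 < t & [/\ t < gap0, lam + t < 1,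
  N.+1%:R ^+ 2 * (lam + t) ^+ d < 1,
  (lam + t) * ((gap0 - t) ^+ 2 + (R0 + t) ^+ 2) < (gap0 - t) ^+ 2 &
  Dl * (1 - lam) / 2 < Dl * (1 - (lam + t))].
Proof.
pose l : {poly R} := lam%:P + 'X; pose g : {poly R} := gap0%:P - 'X.
pose r : {poly R} := R0%:P + 'X.
have h1 := @poly_lt_near R 'X gap0%:P.
have h2 := @poly_lt_near R l 1%:P.
have h3 := @poly_lt_near R ((N.+1%:R ^+ 2)%:P * l ^+ d) 1%:P.
have h4 := @poly_lt_near R (l * (g ^+ 2 + r ^+ 2)) (g ^+ 2).
have h5 := @poly_lt_near R (Dl * (1 - lam) / 2)%:P (Dl%:P * (1%:P - l)).
have D0 := pole_dist_bound_gt0; have l1 : 0 < 1 - lam by rewrite subr_gt0.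
have D1 : 0 < Dl * (1 - lam) by rewrite mulr_gt0.
rewrite !(hornerM, hornerD, horner_exp, hornerN, hornerC, hornerX) ?addr0 ?subr0 in h1 h2 h3 h4 h5.
have /filter_ex[t [[t0 H1 H2] [H3 H4 H5]]] : \forall t \near (0 : R)^'+,
  [/\ 0 < t, 'X.[t] < gap0%:P.[t] & l.[t] < 1%:P.[t]] /\
  [/\ ((N.+1%:R ^+ 2)%:P * l ^+ d).[t] < 1%:P.[t],
     (l * (g ^+ 2 + r ^+ 2)).[t] < (g ^+ 2).[t] &
     (Dl * (1 - lam) / 2)%:P.[t] < (Dl%:P * (1%:P - l)).[t]].
  apply: filterI.
    apply: filterS3 (nbhs_right_gt 0) (h1 gap0_gt0) (h2 hlam1) => t; split => //.
  apply: filterS3 (h3 hdim) (h4 hK) (h5 _) => [t|]; first by split.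
  lra.
move: H1 H2 H3 H4 H5.
rewrite !(hornerM, hornerD, horner_exp, hornerN, hornerC, hornerX) => *.
by exists t.
Qed.

Lemma clip_le (eps : R) (s : V) : 0 <= eps -> enorm (clip eps s) <= eps.
Proof. by move=> e0; rewrite /clip; case: ifP => // _; rewrite enorm0. Qed.

Lemma clip_id (eps : R) (s : V) : enorm s <= eps -> clip eps s = s.
Proof. by rewrite /clip => ->. Qed.

Lemma clip0 (eps : R) : clip eps (0 : V) = 0.
Proof. by rewrite /clip; case: ifP. Qed.

Lemma inv_image_margin : exists2 c : R, 0 < c & forall i x y, closure Omega x ->
  enorm (y - finite_part (Phi i) x) <= c -> Omega y.
Proof.
apply: ord_uniform_pos => [i c c' _ cc h x y Ox xy|i].
  by apply: (h x y Ox); exact: le_trans cc.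
have [_ oOm _] := hOmega; have [_ _ him _] := hPhi i.
have [c c0 hc] := compact_image_margin (compact_closure_bounded bOm) oOm
  (fun x Ox => differentiable_continuous (ex_diff (is_diff_def :=
     is_diff_invmap (b i) (k i) (Oi i) (inv_pole_neq i (hsub Ox))))) him.
by exists c => // x y; exact: hc.
Qed.

Lemma shift_far i x (s : V) : closure Omega x ->
  Dl - enorm s <= enorm (x - (p i + s)).
Proof.
move=> Ox; have := pole_dist_bound_le i Ox; have := ler_enormD (x - (p i + s)) s.
by rewrite opprD addrA subrK; lra.
Qed.

Lemma inv_shift_continuity (eta : R) : 0 < eta -> exists2 c : R, 0 < c &
  forall i x s, closure Omega x -> enorm s <= c ->
  enorm (finite_part (invmap (b i) (k i) (p i + s) (Oi i)) x -
         finite_part (Phi i) x) <= eta.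
Proof.
move=> eta0; have D0 := pole_dist_bound_gt0.
apply: ord_uniform_pos => [i c c' _ cc h x s Ox sc|i].
  by apply: h => //; exact: le_trans cc.
(* The first bound keeps the moved pole at distance Dl/2, so the displacement k|s|/(|x-p-s||x-p|) is
   at most 2k|s|/Dl^2. *)
pose c := Num.min (Dl / 2) (eta * Dl ^+ 2 / (2 * k i)).
exists c => [|x s Ox].
  rewrite lt_min divr_gt0//=; apply: divr_gt0; apply: mulr_gt0 => //.
  exact: exprn_gt0.
rewrite le_min => /andP[s1 s2].
have f1 := shift_far i s Ox; have f2 := pole_dist_bound_le i Ox.
have h1 : Dl / 2 <= enorm (x - (p i + s)) by lra.
have n1 : x != p i + s by apply: enorm_sub_gt0 h1; rewrite divr_gt0.
have n2 : x != p i by exact: enorm_sub_gt0 f2.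
rewrite !finite_part_invmap// [X in X - _]addrC addrKA.
rewrite -scalerBr -mulmxBl enormZ enorm_mulmx// gtr0_norm//.
rewrite enorm_sphinvB ?subr_eq0//.
have -> : x - (p i + s) - (x - p i) = - s.
  by apply/rowP => j; rewrite !mxE; ring.
rewrite enormN mulrA ler_pdivrMr; last by rewrite mulr_gt0// enorm_gt0 subr_eq0.
apply: le_trans (_ : eta * (Dl / 2 * Dl) <= _); last first.
  by rewrite ler_pM2l// ler_pM// ltW// divr_gt0.
move: s2; rewrite ler_pdivlMr ?mulr_gt0//; lra.
Qed.

Lemma inv_C2_continuity (e : R) : 0 < e -> exists2 c : R, 0 < c &
  forall i s, enorm s <= c ->
  (C2_dist Omega (finite_part (Phi i))
     (finite_part (invmap (b i) (k i) (p i + s)%R (Oi i))) <= e%:E)%E.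
Proof.
move=> e0; have D0 := pole_dist_bound_gt0.
apply: ord_uniform_pos => [i c c' _ cc h s sc|i].
  by apply: h; exact: le_trans cc.
have [x0 Ox0] := closure_point; have [B B0 hB] := bounded_enorm bOm.
have ann x : closure Omega x ->
    Dl <= enorm (x - p i) /\ enorm (x - p i) <= B + enorm (x0 - p i).
  move=> Ox; split; first exact: pole_dist_bound_le.
  by have := ler_enorm_dist x0 x (p i); have := hB x x0 Ox Ox0; lra.
have [C C0 hC] := C2_dist_shift (b i) (k0 i) (hO i) D0 ann.
exists (Num.min (Dl / 2) (e / (C + 1))) => [|s].
  by rewrite lt_min divr_gt0//= divr_gt0// ltr_wpDl.
rewrite le_min => /andP[s1 s2]; apply: le_trans (hC s s1) _; rewrite lee_fin.
move: s2; rewrite ler_pdivlMr ?ltr_wpDl//.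
by have := enorm_ge0 s; lra.
Qed.

Lemma perturbed_mixed_system (t eps : R) : 0 < t -> lam + t < 1 -> 0 < eps ->
  eps < Dl -> lam * Dl ^+ 2 <= (lam + t) * (Dl - eps) ^+ 2 ->
  (forall i x s, closure Omega x -> enorm s <= eps ->
    Omega (finite_part (invmap (b i) (k i) (p i + s) (Oi i)) x) /\
    enorm (finite_part (invmap (b i) (k i) (p i + s) (Oi i)) x -
           finite_part (Phi i) x) <= t) ->
  mixed_system Omega b p k Oi (clip eps) (lam + t) (rho - t) (Dl - eps).
Proof.
move=> t0 lt1 e0 eD hl hs; have [_ oOm _] := hOmega; have l0 := lam_gt0.
have ce (v : V) : enorm (clip eps v) <= eps by apply: clip_le; exact: ltW.
have D0 := pole_dist_bound_gt0.
split => //.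
- exact: addr_gt0.
- by rewrite subr_gt0.
- by move=> [i s] x Ox; have [] := hs i x _ Ox (ce s).
- move=> [i s] x Ox /=; have h1 := inv_lambda i Ox; have h2 := pole_dist_bound_le i Ox.
  have h3 : enorm (x - p i) - eps <= enorm (x - (p i + clip eps s)).
    have := ler_enormD (x - (p i + clip eps s)) (clip eps s).
    by rewrite opprD addrA subrK; have := ce s; lra.
  apply: le_trans h1 _; move: h2 h3.
  move: (enorm (x - p i)) (enorm (x - (p i + _))) => X Y h2 h3.
  have X0 : 0 < X by exact: lt_le_trans h2.
  (* [X - eps >= X (Dl - eps) / Dl] since [X >= Dl] *)
  have h4 : X * (Dl - eps) <= Dl * Y by nra.
  have DD : 0 < Dl ^+ 2 by rewrite exprn_gt0.
  rewrite -(ler_pM2l DD); apply: le_trans (_ : (lam + t) * (X * (Dl - eps)) ^+ 2 <= _).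
    have := ler_wpM2r (sqr_ge0 X) hl; lra.
  rewrite [leRHS]mulrCA -exprMn; apply: ler_wpM2l; first by rewrite addr_ge0// ltW.
  have ed : 0 <= Dl - eps by rewrite subr_ge0 ltW.
  by rewrite lerXn2r// nnegrE mulr_ge0 ?(ltW D0) ?(ltW X0)//; lra.
- move=> [i s] x Ox /=; apply: le_trans (shift_far _ _ Ox).
  by have := ce s; lra.
- by move=> i y nOy; have := rho_b_le_centre p k Oi oOm (hb i) nOy; rewrite -/rho; lra.
- move=> [i s] x y Ox nOy; have [_ h] := hs i x _ Ox (ce s).
  have [_ _ him _] := hPhi i.
  have Ofx : Omega (finite_part (Phi i) x) by apply: him; exists x.
  have := rho_b_le_image oOm Ox Ofx nOy; rewrite -/rho.
  rewrite /letter_map /=; move: (finite_part _ x) (finite_part _ x) h => f z h hr.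
  by have := ler_enorm_dist z y f; lra.
Qed.

(** * Pole bounds and transversality for a fixed size of the perturbation *)

Section Perturbation.
Variables (t eps : R).
Hypothesis t0 : 0 < t.
Hypothesis tgap : t < gap0.
Hypothesis lt1 : lam + t < 1.
Hypothesis Kt : (lam + t) * ((gap0 - t) ^+ 2 + (R0 + t) ^+ 2) < (gap0 - t) ^+ 2.
Hypothesis eps0 : 0 < eps.
Hypothesis Deps : Dl * (1 - lam) / 2 < (Dl - eps) * (1 - (lam + t)).
Hypothesis sys :
  mixed_system Omega b p k Oi (clip eps) (lam + t) (rho - t) (Dl - eps).
Hypothesis small : eps * ((gap0 - t) ^+ 2 * (1 - (lam + t)) +
  (lam + t) * (R0 + t) ^+ 2) <= t / 2 * ((gap0 - t) ^+ 2 * (1 - (lam + t))).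

Local Notation word_pole := (@word_pole R d 'I_N.+1 V b p k Oi (clip eps)).
Local Notation pgap := (pole_gap (lam + t) (rho - t) (Dl - eps)).
Local Notation P w := (word_pole (shifted (fun=> 0) w)).

Lemma pole_gap_ge : gap0 - t <= pgap.
Proof.
have h1 : rho - t <= pgap by rewrite le_max lexx.
have h2 : (Dl - eps) * (1 - (lam + t)) <= pgap by rewrite le_max lexx orbT.
rewrite lerBlDr /gap0 ge_max two_over_C_0; apply/andP; split; first by lra.
by apply: le_trans (ltW Deps) _; apply: le_trans h2 _; rewrite lerDl ltW.
Qed.

Lemma pole_word_inv w : w <> [::] -> pole (word_map Phi w) = Some (P w).
Proof.
have -> : Phi = shifted_system b p k Oi eps (fun=> 0).
  apply/funext => i; rewrite /shifted_system /letter_map /= clip0 addr0 //.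
move=> w0; rewrite word_map_shifted.
have [bw [kw [Ow [[_ _ -> _] _]]]] := word_dataN0 sys (shifted_neq0 (sg := fun=> 0) w0).
exact: pole_invmap.
Qed.

(** A rough bound that makes [R_pole] finite. It uses no nearness hypothesis for long words: the
    pole of [i :: w] differs from [p i] by at most the radius of one letter over the gap. *)
Lemma pole_word_bounded : exists C, forall w, w <> [::] ->
  forall x, closure Omega x -> enorm (P w - x) <= C.
Proof.
have [x0 Ox0] := closure_point; have [B B0 hB] := bounded_enorm bOm.
pose C1 := \sum_i enorm (x0 - p i).
have pE i : word_pole [:: (i, 0)] = p i by rewrite /word_pole /= clip0 addr0.
have hC1 i : enorm (x0 - p i) <= C1.
  by rewrite /C1 (bigD1 i)//= lerDl sumr_ge0// => j _; exact: enorm_ge0.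
have C10 : 0 <= C1 by apply: sumr_ge0 => j _; exact: enorm_ge0.
have C20 : 0 <= C1 ^+ 2 / pgap.
  by rewrite divr_ge0 ?sqr_ge0// ltW// (pole_gap_gt0 sys).
exists (C1 ^+ 2 / pgap + (C1 + B)) => -[//|i w] _ x Ox.
have h1 : enorm (P (i :: w) - p i) <= C1 ^+ 2 / pgap.
  case: w => [|j w]; first by rewrite pE subrr enorm0.
  have u0 : [:: (i, 0 : V)] <> [::] by [].
  have v0 : shifted (fun=> 0 : V) (j :: w) <> [::] by [].
  have := @word_pole_cat_near _ _ _ _ _ _ _ _ _ _ _ _ _ sys C1 _ _ u0 v0.
  rewrite pE expr1 => /(_ _)/le_trans; apply; first by exists x0; rewrite ?pE.
  by rewrite ler_piMl// ltW.
have := ler_enorm_dist (p i) (P (i :: w)) x; have := ler_enorm_dist x0 (p i) x.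
rewrite (enormB (p i) x0); have := hC1 i; have := hB x0 x Ox0 Ox.
by lra.
Qed.

Lemma near_pole_inv w : w <> [::] ->
  near_pole Omega b p k Oi (clip eps) (R0 + t / 2) (shifted (fun=> 0) w).
Proof.
move=> w0; have [C hC] := pole_word_bounded.
have [Om0 _ _] := hOmega.
have t20 : 0 < t / 2 by rewrite divr_gt0.
by have [x Ox hx] := R_pole_near t20 Om0 pole_word_inv hC w0; exists x.
Qed.

Lemma R0t_gt0 : 0 < R0 + t.
Proof.
have w0 : [:: ord0 : 'I_N.+1] <> [::] by [].
have [x _ hx] := near_pole_inv w0.
by have := le_trans (enorm_ge0 _) hx; have := t0; lra.
Qed.

Lemma transversal_lt1 : (lam + t) * (((R0 + t) / pgap) ^+ 2 / (1 - (lam + t))) < 1.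
Proof.
have g0 : 0 < gap0 - t by rewrite subr_gt0.
have pg := pole_gap_ge; have pg0 := lt_le_trans g0 pg.
have l10 : 0 < 1 - (lam + t) by rewrite subr_gt0.
have lt0 : 0 < lam + t by exact: ms_lam_gt0 sys.
rewrite mulrA ltr_pdivrMr// mul1r expr_div_n mulrA ltr_pdivrMr ?exprn_gt0//.
have h : (gap0 - t) ^+ 2 <= pgap ^+ 2 by rewrite lerXn2r// nnegrE ltW.
apply: lt_le_trans (_ : (1 - (lam + t)) * (gap0 - t) ^+ 2 <= _); last first.
  by rewrite ler_wpM2l// ltW.
by have := Kt; lra.
Qed.

(** The bootstrap from [R0 + t / 2] to [R0 + t]: the left word of the telescope has zero
    translations, hence is a word of the given system, and the pole of the mixed word is within t/2
    of its pole. *)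
Lemma near_pole_mixed w : w <> [::] -> near_pole Omega b p k Oi (clip eps) (R0 + t) w.
Proof.
case: w => [//|[i s] w] _.
pose T (w : seq ('I_N.+1 * V)) := [seq (q.1, 0 : V, q.2) | q <- w].
have lE (v : seq ('I_N.+1 * V)) : left_word (T v) = shifted (fun=> 0) (map fst v).
  by rewrite /left_word /T /shifted -!map_comp; apply: eq_map => -[].
have rE (v : seq ('I_N.+1 * V)) : right_word (T v) = v.
  by rewrite /right_word /T -map_comp -[RHS]map_id; apply: eq_map => -[].
pose Q := [pred q : 'I_N.+1 * V | q.2 == 0].
have hQ v : v <> [::] -> all Q v -> near_pole Omega b p k Oi (clip eps) (R0 + t / 2) v.
  move=> v0 Qv; have -> : v = shifted (fun=> 0) (map fst v).
    rewrite /shifted -map_comp -[LHS]map_id; apply/eq_in_map => -[j s'] /(allP Qv) /= /eqP ->.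
    by [].
  by apply: near_pole_inv; case: v v0 {Qv}.
have ce (v : V) : enorm (clip eps v) <= eps by apply: clip_le; exact: ltW.
have l0 : 0 < lam + t by exact: ms_lam_gt0 sys.
have hT : all (fun q => enorm (clip eps q.1.2 - clip eps q.2) <= eps) (T ((i, s) :: w)).
  by rewrite /T all_map; apply/allP => q _ /=; rewrite clip0 sub0r enormN.
have QT : all Q (left_word (T ((i, s) :: w))).
  by rewrite lE /shifted all_map; apply/allP => q _ /=; rewrite eqxx.
have := word_pole_perturb sys hQ QT hT.
rewrite -[_ :: map _ _]/(T ((i, s) :: w)) lE rE clip0 sub0r opprK.
set Pw := P _; set Pm := word_pole _ => hP.
have fw0 : map fst ((i, s) :: w) <> [::] by [].
have [x Ox hx] := near_pole_inv fw0.
exists x => //; rewrite -/Pm.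
(* [small] is this bound with [pgap] lowered to [gap0 - t], [R0 + t / 2] raised to [R0 + t], and
   denominators cleared. *)
have bnd : (lam + t) * (((R0 + t / 2) / pgap) ^+ 2 * eps / (1 - (lam + t))) + eps <= t / 2.
  have r0 : 0 <= R0 + t / 2 by exact: le_trans (enorm_ge0 _) hx.
  have G0 : 0 < gap0 - t by rewrite subr_gt0.
  have l10 : 0 < 1 - (lam + t) by rewrite subr_gt0.
  have pg0 := lt_le_trans G0 pole_gap_ge.
  have aA : ((R0 + t / 2) / pgap) ^+ 2 <= ((R0 + t) / (gap0 - t)) ^+ 2.
    have rt : R0 + t / 2 <= R0 + t by have := t0; lra.
    have Rt0 := le_trans r0 rt.
    rewrite lerXn2r// ?nnegrE ?divr_ge0 ?(ltW pg0) ?(ltW G0)//.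
    by rewrite ler_pM ?invr_ge0 ?(ltW pg0)// lef_pV2 ?posrE// pole_gap_ge.
  apply: le_trans (_ : (lam + t) *
      (((R0 + t) / (gap0 - t)) ^+ 2 * eps / (1 - (lam + t))) + eps <= _).
    by rewrite lerD2r ler_wpM2l ?(ltW l0)// ler_wpM2r ?invr_ge0 ?(ltW l10)// ler_wpM2r// ltW.
  have := small; rewrite -ler_pdivrMr ?mulr_gt0 ?exprn_gt0//.
  apply: le_trans; rewrite le_eqVlt; apply/orP; left; apply/eqP.
  by move: (gap0 - t) (1 - (lam + t)) G0 l10 => G L G0 L0; field; rewrite !gt_eqF.
have := ler_enorm_dist Pw x Pm; have := ler_enormB (Pw - Pm + clip eps s) (clip eps s).
by rewrite addrK; have := ce s; move: hx; rewrite -/Pw; have := t0; lra.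
Qed.

End Perturbation.

Lemma shifted_letter_moebius (eps : R) (sg : 'I_N.+1 -> V) i :
  moebius (shifted_system b p k Oi eps sg i).
Proof.
have [mi _ _ _] := hPhi i.
have -> : shifted_system b p k Oi eps sg i =
    Phi i \o similarity 1 1%:M (- clip eps (sg i)).
  rewrite /inv_system invmap_sim// ?trmx1 ?mulmx1// /shifted_system /letter_map /=.
  by rewrite divr1 invr1 scale1r opprK mul1mx.
apply: moebius_comp => //; apply: moebius_similarity.
by exists 1, 1%:M, (- clip eps (sg i)); rewrite trmx1 mulmx1.
Qed.

Lemma shifted_cifs (t eps c : R) (sg : 'I_N.+1 -> V) : lam + t < 1 -> 0 <= eps -> eps < c ->
  (forall i y, Omega' y -> c <= enorm (y - p i)) ->
  mixed_system Omega b p k Oi (clip eps) (lam + t) (rho - t) (Dl - eps) ->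
  is_cifs Omega Omega' (shifted_system b p k Oi eps sg).
Proof.
move=> lt1 e0 ec hc sys i.
have far x : Omega' x -> x != p i + clip eps (sg i).
  move=> Ox; rewrite -subr_eq0 -enorm_gt0.
  have := ler_enormD (x - (p i + clip eps (sg i))) (clip eps (sg i)).
  by rewrite opprD addrA subrK; have := hc i x Ox; have := clip_le (sg i) e0; lra.
split.
- exact: shifted_letter_moebius.
- by move=> x Ox; rewrite /shifted_system /letter_map invmap_fin//; exact: far.
- by move=> _ [x Ox <-]; exact: (ms_map_in sys).
- move=> x Ox; have xp := far x (hsub Ox).
  rewrite /shifted_system /letter_map opnorm_jacobian_invmap//.
  rewrite /qinv -enorm_sqr ltr_pdivrMr ?exprn_gt0 ?enorm_gt0 ?subr_eq0// mul1r.
  apply: le_lt_trans (ms_contract sys (i, sg i) Ox) _ => /=.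
  by rewrite gtr_pMl// exprn_gt0// enorm_gt0 subr_eq0.
Qed.

(** The relaxation [t] is fixed before [eps]: the translations must keep images in [Omega] and poles
    off [Omega'], stay [e]-close in [d2], and move the poles of words by at most t/2. *)
Lemma inv_system_closure : d2_closure Omega Omega' (G_T Omega Omega') Phi.
Proof.
split=> // e e0.
have [t t0 [tgap lt1 dimt Kt Dt]] := margin.
have D0 := pole_dist_bound_gt0; have l0 := lam_gt0.
have [cO cO0 hO'] := inv_image_margin.
have [cI cI0 hI] : exists2 c : R, 0 < c & forall i x s, closure Omega x -> enorm s <= c ->
    enorm (finite_part (invmap (b i) (k i) (p i + s) (Oi i)) x -
           finite_part (Phi i) x) <= Num.min cO t.
  by apply: inv_shift_continuity; rewrite lt_min cO0.
have e20 : 0 < e / 2 by rewrite divr_gt0.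
have [cC cC0 hC] := inv_C2_continuity e20.
have [cp cp0 hp] := inv_pole_away.
have l10 : 0 < 1 - (lam + t) by rewrite subr_gt0.
have g0 : 0 < (gap0 - t) ^+ 2 * (1 - (lam + t)).
  by rewrite mulr_gt0// exprn_gt0// subr_gt0.
pose M := (gap0 - t) ^+ 2 * (1 - (lam + t)) + (lam + t) * (R0 + t) ^+ 2.
have M0 : 0 < M.
  by rewrite /M ltr_wpDr// mulr_ge0 ?sqr_ge0// (addr_ge0 (ltW l0) (ltW t0)).
have h1 := @poly_lt_near R (lam * Dl ^+ 2)%:P ((lam + t)%:P * (Dl%:P - 'X) ^+ 2).
have h2 := @poly_lt_near R (Dl * (1 - lam) / 2)%:P ((Dl%:P - 'X) * (1 - (lam + t))%:P).
rewrite !(hornerM, hornerD, horner_exp, hornerN, hornerC, hornerX) ?subr0 in h1 h2.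
have H1 : lam * Dl ^+ 2 < (lam + t) * Dl ^+ 2.
  by rewrite ltr_pM2r ?exprn_gt0// ltrDl.
have small0 : 0 < t / 2 * ((gap0 - t) ^+ 2 * (1 - (lam + t))) / M.
  by rewrite divr_gt0// mulr_gt0// divr_gt0.
have F1 : \forall eps \near (0 : R)^'+, [/\ 0 < eps, eps <= cI & eps <= cC].
  by apply: filterS3 (nbhs_right_gt 0) (nbhs_right_le cI0) (nbhs_right_le cC0) => x.
have F2 : \forall eps \near (0 : R)^'+, [/\ eps < cp, eps < Dl &
    eps <= t / 2 * ((gap0 - t) ^+ 2 * (1 - (lam + t))) / M].
  by apply: filterS3 (nbhs_right_lt cp0) (nbhs_right_lt D0) (nbhs_right_le small0) => x.
have [eps [[[eps0 epsI epsC] [epsp epsD epsM]] [E1 E2]]] :=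
  filter_ex (filterI (filterI F1 F2) (filterI (h1 H1) (h2 Dt))).
move: E1 E2; rewrite !(hornerM, hornerD, horner_exp, hornerN, hornerC, hornerX) => E1 E2.
have sys : mixed_system Omega b p k Oi (clip eps) (lam + t) (rho - t) (Dl - eps).
  apply: perturbed_mixed_system => //; first exact: ltW.
  move=> i x s Ox se; have := hI i x s Ox (le_trans se epsI).
  by rewrite le_min => /andP[x1 x2]; split=> //; exact: hO' x1.
have smallM : eps * M <= t / 2 * ((gap0 - t) ^+ 2 * (1 - (lam + t))).
  by rewrite -ler_pdivlMr.
have near := near_pole_mixed t0 tgap lt1 eps0 E2 sys smallM.
have [sg [hsg [c c0 sep]]] := pole_separation d0 sys eps0
  (R0t_gt0 t0 lt1 sys) near dimt (transversal_lt1 t0 tgap lt1 Kt E2 sys).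
have [Om0 _ _] := hOmega.
have cifs := shifted_cifs sg lt1 (ltW eps0) epsp hp sys.
exists (shifted_system b p k Oi eps sg).
  exact: (separated_G_T d0 sys near Om0 bOm cifs c0 sep).
apply: le_lt_trans (_ : ((e / 2)%:E < _)%E); last first.
  by rewrite lte_fin ltr_pdivrMr// ltr_pMr// ltr1n.
apply: bigmax_le => [|i _]; first exact: leNye.
rewrite /shifted_system /letter_map /= clip_id//.
by apply: hC; exact: le_trans epsC.
Qed.

End Closure.

Theorem theorem11p9 (R : realType) (d N : nat)
  (hd : (3 <= d)%N) (hN : (2 <= N)%N)
  (Omega Omega' : set 'rV[R]_d)
  (hOmega : is_domain Omega) (hbounded : bounded_set Omega)
  (hOmega' : is_domain Omega') (hsub : closure Omega `<=` Omega')
  (Phi : 'I_N -> extended_space R d -> extended_space R d)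
  (hPhi : is_cifs Omega Omega' Phi)
  (hnosim : forall i : 'I_N, ~ is_similarity (Phi i))
  (hpole : forall i : 'I_N, (0 < point_dist (pole (Phi i)) Omega')%E)
  (hb : forall i : 'I_N, (Some @` Omega) (Phi i None))
  (hlambda : lambda_max Omega Phi <
     Num.min (1 / (N%:R `^ (2 / d%:R))) (1 / (1 + K_const Omega Phi))) :
  d2_closure Omega Omega' (G_T Omega Omega') Phi.
Proof.
have d0 : (0 < d)%N by exact: leq_trans hd.
case: N hN Phi hPhi hnosim hpole hb hlambda => [//|N] _ Phi hPhi hnosim hpole hb hlambda.
have nf i : {D : 'rV[R]_d * R * 'rV[R]_d * 'M[R]_d | [/\ 0 < D.1.1.2,
    D.2 *m D.2^T = 1%:M & Phi i = invmap D.1.1.1 D.1.1.2 D.1.2 D.2]}.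
  apply: cid; have [m _ _ _] := hPhi i.
  have [/hnosim//|[b [k [p [Oi [k0 hO E]]]]]] := moebius_normal_form m.
  by exists (b, k, p, Oi).
pose b i := (sval (nf i)).1.1.1; pose k i := (sval (nf i)).1.1.2.
pose p i := (sval (nf i)).1.2; pose Oi i := (sval (nf i)).2.
have k0 i : 0 < k i by rewrite /k; case: (nf i) => D [].
have hO i : Oi i *m (Oi i)^T = 1%:M by rewrite /Oi; case: (nf i) => D [].
have PhiE : Phi = inv_system b p k Oi.
  by apply/funext => i; rewrite /inv_system /b /k /p /Oi; case: (nf i) => D [].
have bO i : Omega (b i).
  by have [y Oy] := hb i; rewrite PhiE /inv_system /= => -[<-].
move: hPhi hpole hlambda; rewrite PhiE => hPhi hpole.
rewrite lt_min => /andP[lamN lamK].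
have K0 : 0 <= K_const Omega (inv_system b p k Oi) by rewrite divr_ge0 ?sqr_ge0.
have K1 : 0 < 1 + K_const Omega (inv_system b p k Oi) by rewrite ltr_wpDr.
have lam1 : lambda_max Omega (inv_system b p k Oi) < 1.
  by apply: lt_le_trans lamK _; rewrite ler_pdivrMr// mul1r lerDl.
have lam0 := lam_gt0 d0 k0 hO hOmega hsub hPhi hpole.
have gap0 := gap0_gt0 d0 k0 hO hOmega hsub hpole lam1.
apply: inv_system_closure => //; first exact: lt_dim_bound.
(* The remaining hypothesis is lam (1 + K) < 1 multiplied by the square of the gap. *)
move: lamK; rewrite ltr_pdivlMr// /K_const => lamK.
have g2 : 0 < Num.max (rho_b Omega (inv_system b p k Oi))
    (2 / C_0 Omega (inv_system b p k Oi)) ^+ 2 by rewrite exprn_gt0.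
rewrite -(ltr_pM2r g2) mul1r in lamK; apply: le_lt_trans lamK.
by rewrite le_eqVlt; apply/orP; left; apply/eqP; field; rewrite gt_eqF.
Qed.
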